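(* Let $n\ge 2$, and let $I,J,K,L$ be $2$-element subsets of $[1,n]$ with $n\in I$, $n\in J$, $n\in K$. Let $i,j,k,l$ be the smallest elements of $I,J,K,L$ respectively. Then the quantities $c^{K,L}_{I,J}$ (defined in the context for $\mathrm{Gr}(2,n)$) satisfy: 1. $c^{K,L}_{I,J}=0$ unless $n\in L$ and $k\le l\le i$, $l\le j$; 2. when $k<i$, $k\le l\le i\le j$ and $n\in L$, $$c^{K,L}_{I,J}=\begin{cases}\mathrm{Res}_{z=0}\left(\dfrac{h^n(z+h)^{i+j-k-3}}{z^{i+j-k-n+2}}\right)&\text{if }l=k,\\[2mm] \mathrm{Res}_{z=0}\left(\dfrac{2h^{n+1}(z+h)^{i+j+k-2l-3}(z+3h)^{l-k-1}}{z^{i+j-l-n+2}}\right)&\text{if }k<l<i,\\[2mm] \mathrm{Res}_{z=0}\left(\dfrac{2h^{n-\delta_{i,j}}(z+h)^{k-1+(j-i-1)(1-\delta_{i,j})}(z+3h)^{i-k-1}}{z^{j-n+2}}\right)&\text{if }l=i;\end{cases}$$ 3. when $k=l=i\le j$ (with $K=L=I$), $c^{I,I}_{I,J}=h^{2(n-2)}$ if $j=n-1$, and $c^{I,I}_{I,J}=0$ otherwise.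
   Context: $[1,n]=\{1,\dots,n\}$, $\delta_{i,j}$ is the Kronecker delta, $h$ is a formal parameter (treated as a constant in integrals and residues). Elements of a subset are listed in increasing order, $I=\{i_1<i_2\}$. Cohomological weight functions for $\mathrm{Gr}(2,n)$: for $a\in\{1,2\}$, $b\in[1,n]$, let $\Psi_{I,a,b}(x)=x+h$ if $b<i_a$, $=h$ if $b=i_a$, $=x$ if $b>i_a$. Put $$U_I(t_1,t_2;z_1,\dots,z_n;h)=\prod_{a=1}^2\prod_{b=1}^n\Psi_{I,a,b}(z_b-t_a)\prod_{1\le a<b\le 2}\frac1{t_b-t_a}\prod_{1\le b\le a\le 2}\frac1{t_b-t_a+h},$$ and for $\sigma\in S_n$, $W_{\sigma,I}=\mathrm{Sym}_{t_1,t_2}\,U_{\sigma^{-1}(I)}(t_1,t_2;z_{\sigma(1)},\dots,z_{\sigma(n)};h)$, where $\mathrm{Sym}_{t_1,t_2}$ is the sum over the two permutations of $t_1,t_2$. Let $s_0\in S_n$ be the longest permutation, $s_0(b)=n+1-b$. For $L=\{l_1<l_2\}$ put $R_L=\prod_{a\in L,\,b\notin L}(z_b-z_a)$, $Q_L=\prod_{a\in L,\,b\notin L}(z_b-z_a+h)$, and $$\hat c^{K,L}_{I,J}=\frac{\big(W_{\mathrm{id},I}\,W_{\mathrm{id},J}\,W_{s_0,K}\big)(z_{l_1},z_{l_2};z_1,\dots,z_n;h)}{R_LQ_L}.$$ (The sums $\sum_L\hat c^{K,L}_{I,J}$ are the torus-equivariant structure constants of $\mathrm{Gr}(2,n)$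 for the basis of CSM classes of Schubert cells.) For $1\le b\le n$ let $\gamma_b\subset\mathbb{C}$ be the counterclockwise circle centered at $0$ of radius $1/(b+1)$, and define $$c^{K,L}_{I,J}=\left(\frac1{2\pi\sqrt{-1}}\right)^n\int_{\gamma_n}\cdots\int_{\gamma_1}\frac{\hat c^{K,L}_{I,J}}{z_1\cdots z_n}\,dz_1\cdots dz_n,$$ where $\hat c^{K,L}_{I,J}$ is taken in fully cancelled (reduced) form. *)

(* Defs.v *)
From mathcomp Require Import all_boot all_order all_algebra all_fingroup.
From mathcomp Require Import all_classical all_reals all_analysis.
From mathcomp Require Import complex.
From mathcomp Require mpoly.
(* The notations of mpoly cannot be loaded together with MathComp-Analysis. *)
Import -(notations) mpoly.
Import Order.TTheory GRing.Theory Num.Theory.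

Set Implicit Arguments.
Unset Strict Implicit.
Unset Printing Implicit Defensive.

Local Open Scope ring_scope.
Local Open Scope complex_scope.

(* The element b of [1,n] is represented by the ordinal of value b - 1 in 'I_n;
   [labels I] lists the elements of I, as numbers in [1,n], in increasing order
   (enum on 'I_n is increasing), and [elem I a] is the number i_(a+1). *)
Definition labels (n : nat) (I : {set 'I_n}) : seq nat :=
  [seq (val b).+1 | b <- enum I].

Definition elem (n : nat) (I : {set 'I_n}) (a : nat) : nat :=
  nth 0%N (labels I) a.

(* Everything up to [chat] is a formula in an arbitrary field E; it is used for
   E = C(z_1, ..., z_n, h), where no denominator below vanishes. *)
Section WeightFunctions.

Variables (E : fieldType) (n : nat).
Implicit Types (I J K L : {set 'I_n}) (t : 'I_2 -> E) (z : 'I_n -> E) (h : E).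

Definition Psi I (a : 'I_2) (b : 'I_n) h (x : E) : E :=
  if (b.+1 < elem I a)%N then x + h
  else if (b.+1 == elem I a)%N then h
  else x.

Definition weightU I t z h : E :=
  (\prod_(a < 2) \prod_(b < n) Psi I a b h (z b - t a))
  * (\prod_(a < 2) \prod_(b < 2 | (a < b)%N) (t b - t a)^-1)
  * (\prod_(a < 2) \prod_(b < 2 | (b <= a)%N) (t b - t a + h)^-1).

Definition weightW (s : {perm 'I_n}) I t z h : E :=
  \sum_(p : {perm 'I_2})
     weightU (s @^-1: I) (fun a => t (p a)) (fun b => z (s b)) h.

Definition s0 : {perm 'I_n} := perm (@rev_ord_inj n).

(* (z_(l_1), z_(l_2)) *)
Definition restrict L z : 'I_2 -> E := fun a => [seq z b | b <- enum L]`_a.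

Definition R_ L z : E :=
  \prod_(a in L) \prod_(b in ~: L) (z b - z a).

Definition Q_ L z h : E :=
  \prod_(a in L) \prod_(b in ~: L) (z b - z a + h).

Definition chat I J K L z h : E :=
  weightW 1%g I (restrict L z) z h * weightW 1%g J (restrict L z) z h
  * weightW s0 K (restrict L z) z h / (R_ L z * Q_ L z h).

End WeightFunctions.

Section RationalFunctions.

Variables (F : fieldType) (m : nat).
Implicit Types (f : {fraction mpoly m F}) (p q d : mpoly m F).

Definition is_reduced_form f p q : Prop :=
  [/\ q != 0, f = tofrac p / tofrac q &
      forall d p' q', p = d * p' -> q = d * q' -> d \is a GRing.unit].

(* Value at v of the reduced form of f.  The reduced form exists and is unique
   up to a scalar, so that neither the default of xget nor the choice matters. *)
Definition reduced_value f (v : 'I_m -> F) : F :=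
  let pq := xget ((0, 1) : mpoly m F * mpoly m F)
              [set pq | is_reduced_form f pq.1 pq.2]%classic in
  meval v pq.1 / meval v pq.2.

End RationalFunctions.

(* Rational functions of (z_1, ..., z_n, h): the last of the n + 1 variables is
   h, and z_b is the variable of index [widen_ord (leqnSn n) b]. *)
Definition var (F : fieldType) (m : nat) (k : 'I_m) : {fraction mpoly m F} :=
  tofrac (mpolyX F (mnm1 k)).

Definition zvar (F : fieldType) (n : nat) (b : 'I_n) :
  {fraction mpoly n.+1 F} := var F (widen_ord (leqnSn n) b).

Definition hvar (F : fieldType) (n : nat) : {fraction mpoly n.+1 F} :=
  var F (@ord_max n).

Definition point (F : Type) (n : nat) (z : 'I_n -> F) (h : F) : 'I_n.+1 -> F :=
  fun k => oapp z h (unlift ord_max k).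

Definition chat_rat (F : fieldType) (n : nat) (I J K L : {set 'I_n}) :
  {fraction mpoly n.+1 F} := chat I J K L (@zvar F n) (hvar F n).

Section Contour.

Variable R : realType.

Definition circle (r t : R) : R[i] := (r * cos t) +i* (r * sin t).
Definition dcircle (r t : R) : R[i] := (- (r * sin t)) +i* (r * cos t).

(* Integral of f over the counterclockwise circle of radius r centered at 0. *)
Definition contour_int (r : R) (f : R[i] -> R[i]) : R[i] :=
  let g t := f (circle r t) * dcircle r t in
  (\int[lebesgue_measure]_(t in `[0, 2 * pi]%classic) complex.Re (g t))%R
  +i* (\int[lebesgue_measure]_(t in `[0, 2 * pi]%classic) complex.Im (g t))%R.

(* Iterated integral with respect to the variables listed in s, the head of s
   being the outermost one; the element b : 'I_n has label b + 1, so that the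
   radius of its circle is 1 / (b + 2). *)
Fixpoint iter_int (n : nat) (s : seq 'I_n) (f : ('I_n -> R[i]) -> R[i])
    (z : 'I_n -> R[i]) : R[i] :=
  if s is b :: s' then
    contour_int (b.+2%:R)^-1
      (fun w => iter_int s' f (fun b' => if b' == b then w else z b'))
  else f z.

(* The formal parameter of c is evaluated at the complex number h. *)
Definition cstruct (n : nat) (I J K L : {set 'I_n}) (h : R[i]) : R[i] :=
  (1 / (2 * pi%:C * 'i%C)) ^+ n *
  iter_int (rev (enum 'I_n))
    (fun z => reduced_value (chat_rat R[i] I J K L) (point z h)
              / \prod_(b < n) z b)
    (fun=> 0).

End Contour.

Section Residue.

Variable F : fieldType.

(* The Laurent expansion at 0 of f in F(z) has principal part
   a_0 / z + a_1 / z^2 + ... : the remainder p / u is regular at 0. *)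
Definition has_principal_part (f : {fraction {poly F}}) (a : seq F) : Prop :=
  exists p u : {poly F}, u.[0] != 0 /\
    f = \sum_(k < size a) tofrac (a`_k)%:P / tofrac 'X ^+ k.+1
        + tofrac p / tofrac u.

Definition residue0 (f : {fraction {poly F}}) : F :=
  xget 0 [set c | exists2 a, has_principal_part f a & c = a`_0]%classic.

End Residue.

(* Main.v *)
Require Import Defs.
From mathcomp Require Import all_boot all_order all_algebra all_fingroup.
From mathcomp Require Import all_classical all_reals all_analysis.
From mathcomp Require Import complex.
From mathcomp Require mpoly.
Import -(notations) mpoly.
Import Order.TTheory GRing.Theory Num.Theory.
Import numFieldNormedType.Exports Normc.
From mathcomp Require Import ring zify.
Set Implicit Arguments.
Unset Strict Implicit.
Unset Printing Implicit Defensive.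
Local Open Scope ring_scope.
Local Open Scope complex_scope.

(** The ordinal c stands for the label c + 1, and n = N + 1, so that the label
    n is [ord_max]; write I = {i, n}, J = {j, n}, K = {k, n}.

    A weight function at the fixed point L contains factors Psi(0), which are
    0 or h.  They make W_(s_0, K) vanish unless n lies in L = {l, n}.  If it
    does, only one of the two terms is left in each of the symmetrizations,
    and it vanishes unless l <= i, l <= j and k <= l respectively, whence the
    first claim.  Under these conditions every factor that involves only z_l,
    z_n and h cancels against the denominators, and for i <= j chat becomes a
    product over the labels c other than l and n ([chat_prod], [step_num]):
       (z_c - z_n + h) * num_c(z_c - z_l) / den_c(z_c - z_l),
    where den_c(u) is u for k <= c <= i and 1 otherwise.  The poles at
    z_c = z_l - h have disappeared.  The polynomials z_c - z_l are prime, so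
    the reduced form takes the value of this quotient wherever the latter is
    defined ([reduced_value_eq]), in particular on the torus of integration.

    All the integrals follow from one principle ([contour_int_quotient]): if
    the roots of Q lie inside the circle and P = D Q + M with deg M < deg Q,
    then the mean of P / Q over the circle, which is its integral against
    dw / (2 pi i w), is D(0), because the mean of M / Q is 0.  Recall
    that |z_1| > ... > |z_n| on the torus.
    - For c < l the variable z_c has at most the pole z_l, which is inside its
      circle; the mean of its factor is the explicit polynomial [low_mean] in
      z_l and z_n.
    - The variable z_l has the poles z_c with l < c <= i, all inside its circle.
      Division by the product of the ('X - z_c) can be done with coefficients
      in the ring of polynomials in the remaining variables, so the mean is a
      polynomial p0 in them.
    - The iterated mean of the polynomial p0 is its value at 0.
    At 0 the divisor becomes 'X^(i - l), so p0(0) is the coefficient of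
    'X^(i - l) in an explicit product ([cstruct_coef]).  Substituting - 'X for
    'X and collecting equal factors gives the numerators of the statement
    ([residue_numerator_lk] and the three lemmas after it), and such a
    coefficient is a residue at 0 ([residue0_polyX]). *)

(** * Means over circles *)

Section CircleMean.

Variable R : realType.
Local Notation mu := (@lebesgue_measure R).
Local Notation turn := (`[0, 2 * pi]%classic : set R).
Implicit Types (f g : R -> R[i]) (c : R[i]) (r t : R).

(** Continuity is asked of the real and imaginary parts separately because the
    integrals are taken on them. *)
Definition ccont g :=
  continuous (fun t => complex.Re (g t) : R) /\
  continuous (fun t => complex.Im (g t) : R).

Definition cint g : R[i] :=
  (\int[mu]_(t in turn) complex.Re (g t))%R
  +i* (\int[mu]_(t in turn) complex.Im (g t))%R.

Lemma eq_cint f g : f =1 g -> cint f = cint g.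
Proof.
by move=> fg; congr (_ +i* _); apply: eq_Rintegral => t _; rewrite fg.
Qed.

Lemma continuous_turn_integrable (g : R -> R) :
  continuous g -> mu.-integrable turn (EFin \o g).
Proof.
move=> gc; apply: continuous_compact_integrable; first exact: segment_compact.
exact: continuous_subspaceT.
Qed.

Lemma ReM (x y : R[i]) : complex.Re (x * y) =
  complex.Re x * complex.Re y - complex.Im x * complex.Im y.
Proof. by case: x y => [a b] [c d]. Qed.

Lemma ImM (x y : R[i]) : complex.Im (x * y) =
  complex.Re x * complex.Im y + complex.Im x * complex.Re y.
Proof. by case: x y => [a b] [c d]. Qed.

Lemma ReD (x y : R[i]) : complex.Re (x + y) = complex.Re x + complex.Re y.
Proof. by case: x y => [a b] [c d]. Qed.

Lemma ImD (x y : R[i]) : complex.Im (x + y) = complex.Im x + complex.Im y.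
Proof. by case: x y => [a b] [c d]. Qed.

Lemma ccont_cst c : ccont (fun=> c).
Proof. by split=> t; exact: cvg_cst. Qed.

Lemma ccontD f g : ccont f -> ccont g -> ccont (fun t => f t + g t).
Proof.
move=> [f1 f2] [g1 g2]; split=> t.
- under eq_fun do rewrite ReD; apply: cvgD; [exact: f1|exact: g1].
- under eq_fun do rewrite ImD; apply: cvgD; [exact: f2|exact: g2].
Qed.

Lemma ccontM f g : ccont f -> ccont g -> ccont (fun t => f t * g t).
Proof.
move=> [f1 f2] [g1 g2]; split=> t.
- under eq_fun do rewrite ReM.
  by apply: cvgB; apply: cvgM; [exact: f1|exact: g1|exact: f2|exact: g2].
- under eq_fun do rewrite ImM.
  by apply: cvgD; apply: cvgM; [exact: f1|exact: g2|exact: f2|exact: g1].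
Qed.

Lemma ccontX f (m : nat) : ccont f -> ccont (fun t => f t ^+ m).
Proof.
move=> fc; elim: m => [|m IH].
  by under eq_fun do rewrite expr0; exact: ccont_cst.
by under eq_fun do rewrite exprS; exact: ccontM.
Qed.

Lemma ccont_prod (T : Type) (s : seq T) (F : T -> R -> R[i]) :
  (forall x, ccont (F x)) -> ccont (fun t => \prod_(x <- s) F x t).
Proof.
move=> Fc; elim: s => [|x s IH].
  by under eq_fun do rewrite big_nil; exact: ccont_cst.
by under eq_fun do rewrite big_cons; exact: ccontM.
Qed.

Lemma ccont_horner (p : {poly R[i]}) f : ccont f -> ccont (fun t => p.[f t]).
Proof.
move=> fc; elim/poly_ind: p => [|p c IH].
  by under eq_fun do rewrite horner0; exact: ccont_cst.
under eq_fun do rewrite hornerMXaddC.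
by apply: ccontD; [exact: ccontM|exact: ccont_cst].
Qed.

Lemma ccontV f : (forall t, f t != 0) -> ccont f -> ccont (fun t => (f t)^-1).
Proof.
move=> f0 [f1 f2].
have ReV t : complex.Re (f t)^-1 =
  complex.Re (f t) / (complex.Re (f t) ^+ 2 + complex.Im (f t) ^+ 2).
  by case: (f t).
have ImV t : complex.Im (f t)^-1 =
  - complex.Im (f t) / (complex.Re (f t) ^+ 2 + complex.Im (f t) ^+ 2).
  by case: (f t) => a b /=; rewrite mulNr.
have N0 t : complex.Re (f t) ^+ 2 + complex.Im (f t) ^+ 2 != 0.
  rewrite paddr_eq0 ?sqr_ge0 // !sqrf_eq0.
  by move: (f0 t); case: (f t) => a b; rewrite eq_complex.
have Nc t : {for t, continuous
    (fun t => complex.Re (f t) ^+ 2 + complex.Im (f t) ^+ 2)}.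
  by apply: cvgD; apply: cvgM; [exact: f1|exact: f1|exact: f2|exact: f2].
split=> t.
- under eq_fun do rewrite ReV.
  by apply: cvgM; [exact: f1|apply: cvgV; [exact: N0|exact: Nc]].
- under eq_fun do rewrite ImV.
  apply: cvgM; first by apply: cvgN; exact: f2.
  by apply: cvgV; [exact: N0|exact: Nc].
Qed.

Lemma ccont_circle r : ccont (circle r).
Proof.
split=> t; rewrite /circle /=; apply: cvgM; try exact: cvg_cst.
- exact: continuous_cos.
- exact: continuous_sin.
Qed.

Lemma cintD f g : ccont f -> ccont g ->
  cint (fun t => f t + g t) = cint f + cint g.
Proof.
move=> [f1 f2] [g1 g2]; rewrite /cint.
under eq_Rintegral do rewrite ReD.
under [in X in _ +i* X]eq_Rintegral do rewrite ImD.
by rewrite !RintegralD //; apply: continuous_turn_integrable.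
Qed.

Lemma cintZ c f : ccont f -> cint (fun t => c * f t) = c * cint f.
Proof.
move=> [f1 f2]; case: c => a b; rewrite /cint.
have h (x : R) (u : R -> R) : continuous u ->
    mu.-integrable turn (EFin \o (fun t => x * u t)).
  move=> uc; apply: continuous_turn_integrable => t.
  by apply: cvgM; [exact: cvg_cst|exact: uc].
under eq_Rintegral do rewrite ReM.
under [in X in _ +i* X]eq_Rintegral do rewrite ImM.
rewrite RintegralB //=; try exact: h.
rewrite RintegralD //=; try exact: h.
by rewrite !RintegralZl //; apply: continuous_turn_integrable.
Qed.

Lemma normc_Re (x : R[i]) : `|complex.Re x| <= normc x.
Proof.
case: x => a b /=; rewrite -sqrtr_sqr ler_wsqrtr // lerDl; exact: sqr_ge0.
Qed.

Lemma normc_Im (x : R[i]) : `|complex.Im x| <= normc x.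
Proof.
case: x => a b /=; rewrite -sqrtr_sqr ler_wsqrtr // lerDr; exact: sqr_ge0.
Qed.

Lemma normc_ge0 (x : R[i]) : 0 <= normc x.
Proof. by case: x => a b; exact: sqrtr_ge0. Qed.

Lemma continuous_normc g : ccont g -> continuous (fun t => normc (g t)).
Proof.
move=> [g1 g2] t.
have E s : normc (g s) =
    Num.sqrt (complex.Re (g s) ^+ 2 + complex.Im (g s) ^+ 2).
  by case: (g s).
under eq_fun do rewrite E.
apply: continuous_comp; last exact: sqrt_continuous.
by apply: cvgD; apply: cvgM; [exact: g1|exact: g1|exact: g2|exact: g2].
Qed.

(** The bound by an integral of [normc] spares the maximum of [g] over the
    circle; the constant 2 comes from treating Re and Im separately. *)
Lemma normc_cint_le f g (b : R) : ccont f -> ccont g ->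
  (forall t, normc (f t) <= b * normc (g t)) ->
  normc (cint f) <= 2 * b * \int[mu]_(t in turn) normc (g t).
Proof.
move=> [f1 f2] gc fg.
have ng := continuous_normc gc.
have bound (u : R -> R) : continuous u ->
    (forall t, `|u t| <= b * normc (g t)) ->
    `|\int[mu]_(t in turn) u t| <= b * \int[mu]_(t in turn) normc (g t).
  move=> uc ug; have iu := continuous_turn_integrable uc.
  apply: (le_trans (le_normr_Rintegral _ iu)) => //.
  rewrite -RintegralZl //; last exact: continuous_turn_integrable.
  apply: le_Rintegral => //.
  - apply: continuous_turn_integrable => t.
    by apply: continuous_comp; [exact: uc|exact: norm_continuous].
  - apply: continuous_turn_integrable => t.
    by apply: cvgM; [exact: cvg_cst|exact: ng].
set B := (X in _ <= X); rewrite /cint.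
have -> : forall x y : R, x +i* y = x%:C + (0 +i* y).
  by move=> x y; rewrite /GRing.add /= addr0 add0r.
apply: (le_trans (le_normcD _ _)) => /=.
rewrite expr0n /= addr0 add0r !sqrtr_sqr.
have -> : B = b * \int[mu]_(t in turn) normc (g t)
            + b * \int[mu]_(t in turn) normc (g t) by rewrite /B; ring.
apply: lerD; apply: bound => // t; apply: le_trans (fg t).
- exact: normc_Re.
- exact: normc_Im.
Qed.


(** De Moivre. *)
Lemma circleX r t (m : nat) : circle r t ^+ m = circle (r ^+ m) (m%:R * t).
Proof.
elim: m => [|m IH]; first by rewrite !expr0 /circle mul0r cos0 sin0 mulr1 mulr0.
rewrite exprS IH /circle -natr1 mulrDl mul1r sinD cosD exprS.
by apply/eqP; rewrite eq_complex /=; apply/andP; split; apply/eqP; ring.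
Qed.

Lemma circle_neq0 r t : r != 0 -> circle r t != 0.
Proof.
move=> r0; rewrite /circle eq_complex /= !mulf_eq0 (negPf r0) /=.
apply/negP => /andP[/eqP c0 /eqP s0]; have := cos2Dsin2 t.
by rewrite c0 s0 expr0n addr0 => /eqP; rewrite eq_sym oner_eq0.
Qed.

Lemma circleV r t : r != 0 -> (circle r t)^-1 = circle r^-1 (- t).
Proof.
move=> r0; apply: (mulfI (circle_neq0 t r0)).
rewrite mulfV ?circle_neq0 // /circle cosN sinN.
apply/eqP; rewrite eq_complex /=; apply/andP; split; apply/eqP; last by field.
rewrite -(cos2Dsin2 t); field; exact: r0.
Qed.

Lemma normc_circle r t : 0 <= r -> normc (circle r t) = r.
Proof.
by move=> r0; rewrite /= !exprMn -mulrDr cos2Dsin2 mulr1 sqrtr_sqr ger0_norm.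
Qed.

Lemma normcX c (m : nat) : normc (c ^+ m) = normc c ^+ m.
Proof. by elim: m => [|m IH]; rewrite ?normc1 // !exprS normcM IH. Qed.

Lemma Rintegral_turn (f F : R -> R) : continuous f ->
  (forall x : R, is_derive x 1 F (f x)) ->
  \int[mu]_(t in turn) f t = F (2 * pi) - F 0.
Proof.
move=> fc dF.
have Fc : continuous F.
  move=> x; apply/differentiable_continuous/derivable1_diffP.
  by have := dF x; case.
rewrite /Rintegral (@continuous_FTC2 _ f F) //.
- by rewrite mulr_gt0 // pi_gt0.
- exact: continuous_subspaceT.
- split.
  + by move=> x _; have := dF x; case.
  + by apply: cvg_at_right_filter; exact: Fc.
  + by apply: cvg_at_left_filter; exact: Fc.
- by move=> x _; rewrite derive1E; case: (dF x).
Qed.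

Lemma trig_turn (m : nat) :
  (cos (m%:R * (2 * pi)) = 1 :> R) * (sin (m%:R * (2 * pi)) = 0 :> R).
Proof.
have -> : m%:R * (2 * pi) = 0 + (pi *+ 2) *+ m :> R.
  by rewrite add0r -mulrnA -[in RHS]mulr_natl natrM; ring.
rewrite (periodicn (@cosD2pi R)) (periodicn (@sinD2pi R)).
by rewrite cos0 sin0.
Qed.

Lemma Rintegral_cosM (m : nat) : (0 < m)%N ->
  \int[mu]_(t in turn) cos (m%:R * t) = 0.
Proof.
move=> m0; have mR : m%:R != 0 :> R by rewrite pnatr_eq0 -lt0n.
have dF (x : R) :
    is_derive x 1 (fun t => m%:R^-1 * sin (m%:R * t)) (cos (m%:R * x)).
  by apply: is_derive_eq; rewrite /GRing.scale /=; field; exact: mR.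
rewrite (Rintegral_turn _ dF); first by rewrite trig_turn !mulr0 sin0 !mulr0 subr0.
move=> t; apply: continuous_comp; last exact: continuous_cos.
by apply: cvgM; [exact: cvg_cst|exact: cvg_id].
Qed.

Lemma Rintegral_sinM (m : nat) : \int[mu]_(t in turn) sin (m%:R * t) = 0.
Proof.
have [->|m0] := posnP m.
  under eq_Rintegral do rewrite mul0r sin0.
  by rewrite Rintegral_cst // mul0r.
have mR : m%:R != 0 :> R by rewrite pnatr_eq0 -lt0n.
have dF (x : R) :
    is_derive x 1 (fun t => - m%:R^-1 * cos (m%:R * t)) (sin (m%:R * x)).
  by apply: is_derive_eq; rewrite /GRing.scale /=; field; exact: mR.
rewrite (Rintegral_turn _ dF); first by rewrite trig_turn !mulr0 cos0; ring.
move=> t; apply: continuous_comp; last exact: continuous_sin.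
by apply: cvgM; [exact: cvg_cst|exact: cvg_id].
Qed.

Lemma ccont_circleM (x : R) r : ccont (fun t => circle r (x * t)).
Proof.
split=> t; rewrite /circle /=; apply: cvgM; try exact: cvg_cst.
- apply: continuous_comp; last exact: continuous_cos.
  by apply: cvgM; [exact: cvg_cst|exact: cvg_id].
- apply: continuous_comp; last exact: continuous_sin.
  by apply: cvgM; [exact: cvg_cst|exact: cvg_id].
Qed.

Lemma cint_circleX r (m : nat) : (0 < m)%N ->
  cint (fun t => circle r t ^+ m) = 0.
Proof.
move=> m0.
rewrite (@eq_cint _ (fun t => (r ^+ m)%:C * circle 1 (m%:R * t))); last first.
  by move=> t; rewrite circleX /circle !mul1r; simpc.
rewrite cintZ; last exact: ccont_circleM.
rewrite /cint /circle /=.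
under eq_Rintegral do rewrite mul1r.
under [in X in _ +i* X]eq_Rintegral do rewrite mul1r.
by rewrite Rintegral_cosM // Rintegral_sinM mulr0.
Qed.

Lemma cint_circleVX r (m : nat) : r != 0 -> (0 < m)%N ->
  cint (fun t => (circle r t)^-1 ^+ m) = 0.
Proof.
move=> r0 m0.
rewrite (@eq_cint _ (fun t => (r^-1 ^+ m)%:C * circle 1 (- m%:R * t))); last first.
  by move=> t; rewrite circleV // circleX /circle !mul1r mulrN mulNr; simpc.
rewrite cintZ; last exact: ccont_circleM.
rewrite /cint /circle /=.
under eq_Rintegral do rewrite mul1r mulNr cosN.
under [in X in _ +i* X]eq_Rintegral do rewrite mul1r mulNr sinN -mulN1r.
rewrite RintegralZl //; last first.
  apply: continuous_turn_integrable => t.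
  apply: continuous_comp; last exact: continuous_sin.
  by apply: cvgM; [exact: cvg_cst|exact: cvg_id].
by rewrite Rintegral_cosM // Rintegral_sinM !mulr0.
Qed.

Lemma cint_cst c : cint (fun=> c) = (2 * pi)%:C * c.
Proof.
have E x : \int[mu]_(t in turn) x = 2 * pi * x.
  have dF (t : R) : is_derive t 1 (fun t => t * x) x.
    by apply: is_derive_eq; rewrite /GRing.scale /=; ring.
  rewrite (Rintegral_turn _ dF) ?mul0r ?subr0 // => t; exact: cvg_cst.
by rewrite /cint !E; case: c => a b; simpc.
Qed.

(** Mean value property: every monomial of positive degree has mean 0, which is
    shown for all the p * 'X^m with m > 0 at once by induction on p. *)
Lemma cint_horner r (p : {poly R[i]}) :
  cint (fun t => p.[circle r t]) = (2 * pi)%:C * p.[0].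
Proof.
have cc := ccont_circle r.
elim/poly_ind: p => [|p c _].
  by rewrite (eq_cint (fun t => horner0 _)) cint_cst horner0.
have E : forall m, cint (fun t => p.[circle r t] * circle r t ^+ m.+1) = 0.
  elim/poly_ind: p => [|p d IH] m.
    rewrite (@eq_cint _ (fun=> 0)) ?cint_cst ?mulr0 // => t.
    by rewrite horner0 mul0r.
  rewrite (@eq_cint _ (fun t => p.[circle r t] * circle r t ^+ m.+2
                               + d * circle r t ^+ m.+1)); last first.
    by move=> t; rewrite hornerMXaddC [in X in _ = X + _]exprS; ring.
  rewrite cintD ?IH ?cintZ ?cint_circleX ?mulr0 ?addr0 //.
  - exact: ccontX.
  - by apply: ccontM; [exact: ccont_horner|exact: ccontX].
  - by apply: ccontM; [exact: ccont_cst|exact: ccontX].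
under eq_fun do rewrite hornerMXaddC.
rewrite cintD; last 2 first.
- by apply: ccontM => //; exact: ccont_horner.
- exact: ccont_cst.
by rewrite (E 0%N) add0r hornerMXaddC mulr0 add0r cint_cst.
Qed.


Lemma geometric_majorant_eq0 (y b q : R) : 0 <= y -> 0 <= q < 1 ->
  (forall m : nat, y <= b * q ^+ m) -> y = 0.
Proof.
move=> y0 /andP[q0 q1] yle; apply/eqP; rewrite eq_le y0 andbT leNgt.
apply/negP => ypos.
have : (b * q ^+ m @[m --> \oo] --> b * 0)%classic.
  by apply: cvgM; [exact: cvg_cst|apply: cvg_expr; rewrite ger0_norm].
rewrite mulr0 => cv; have [N _ lt] := cvgr_lt _ cv y ypos.
by have := lt_le_trans (lt N (leqnn N)) (yle N); rewrite ltxx.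
Qed.

Lemma circle_sub_neq0 r t c : normc c < r -> circle r t - c != 0.
Proof.
move=> cr; rewrite subr_eq0; apply/eqP => E.
have r0 : 0 <= r := le_trans (normc_ge0 c) (ltW cr).
by move: cr; rewrite -E normc_circle ?ltxx.
Qed.

(** With a a root of the denominator, 1 / (w - a) = 1 / w + a / (w (w - a)).
    Removing the factor w - a this way leaves means that vanish by induction on
    the number of roots, so the mean x_m of w^(-m) p / q satisfies
    x_m = a x_(m + 1), hence x_m = a^k x_(m + k) for every k.  As |x_m| is at
    most a constant times r^(-m) and |a| < r, all the x_m vanish. *)
Lemma cint_proper_fraction r (s : seq R[i]) : 0 < r ->
  all (fun a => normc a < r) s ->
  forall (p : {poly R[i]}) (m : nat), (size p <= size s)%N ->
  cint (fun t => (circle r t)^-1 ^+ m *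
                 (p.[circle r t] / \prod_(a <- s) (circle r t - a))) = 0.
Proof.
move=> r0; have r1 : r != 0 by rewrite gt_eqF.
pose q s t : R[i] := \prod_(a <- s) (circle r t - a).
have q0 s' t : all (fun a => normc a < r) s' -> q s' t != 0.
  move=> /allP s'r; rewrite /q prodf_seq_neq0; apply/allP => a /s'r ar.
  exact: circle_sub_neq0.
have cc := ccont_circle r.
have cV : ccont (fun t => (circle r t)^-1).
  by apply: ccontV cc => t; exact: circle_neq0.
have cq s' : ccont (q s').
  by apply: ccont_prod => a; apply: ccontD => //; exact: ccont_cst.
have cf s' (p : {poly R[i]}) m : all (fun a => normc a < r) s' ->
    ccont (fun t => (circle r t)^-1 ^+ m * (p.[circle r t] / q s' t)).
  move=> s'r; apply: ccontM; first exact: ccontX.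
  apply: ccontM; first exact: ccont_horner.
  by apply: ccontV => // t; exact: q0.
elim: s => [|a s IH].
  move=> _ p m; rewrite leqn0 size_poly_eq0 => /eqP ->.
  rewrite (@eq_cint _ (fun=> 0)) ?cint_cst ?mulr0 // => t.
  by rewrite horner0 mul0r mulr0.
move=> /[dup] asr /= /andP[ar sr] p m sp.
pose x m := cint (fun t => (circle r t)^-1 ^+ m * (p.[circle r t] / q (a :: s) t)).
have step k : x k = a * x k.+1.
  pose c := p`_(size s).
  (* Subtracting c times the remaining denominator brings the degree of p down
     to what the induction hypothesis requires. *)
  pose p' := p - c *: \prod_(b <- s) ('X - b%:P).
  have sp' : (size p' <= size s)%N.
    apply/leq_sizeP => i; rewrite leq_eqVlt => /predU1P[<-|si].
      have /monicP := monic_prod_XsubC s xpredT id.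
      rewrite lead_coefE size_prod_XsubC /= => h.
      by rewrite coefB coefZ h mulr1 subrr.
    rewrite coefB coefZ !nth_default ?mulr0 ?subr0 //.
      by rewrite size_prod_XsubC.
    exact: leq_trans si.
  rewrite /x (@eq_cint _ (fun t =>
      a * ((circle r t)^-1 ^+ k.+1 * (p.[circle r t] / q (a :: s) t)) +
      (c * (circle r t)^-1 ^+ k.+1 +
       (circle r t)^-1 ^+ k.+1 * (p'.[circle r t] / q s t)))); last first.
    move=> t; have w0 := circle_neq0 t r1; have wa := circle_sub_neq0 t ar.
    have qs := q0 s t sr; rewrite /q big_cons -/(q s t).
    have -> : p'.[circle r t] = p.[circle r t] - c * q s t.
      rewrite hornerD hornerN hornerZ /q; congr (_ - _ * _).
      by rewrite horner_prod; apply: eq_bigr => b _; rewrite hornerXsubC.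
    rewrite !exprS; move: ((circle r t)^-1 ^+ k) => y; field.
    by apply/and3P; split.
  rewrite cintD; last 2 first.
  - by apply: ccontM; [exact: ccont_cst|exact: cf].
  - apply: ccontD; last exact: cf.
    by apply: ccontM; [exact: ccont_cst|exact: ccontX].
  rewrite cintD ?cintZ ?cint_circleVX ?IH ?mulr0 ?addr0 //.
  all: try exact: cf.
  all: try by apply: ccontX.
  all: try by apply: ccontM; [exact: ccont_cst|exact: ccontX].
have iter k : x m = a ^+ k * x (m + k)%N.
  elim: k => [|k E]; first by rewrite addn0 expr0 mul1r.
  by rewrite E step addnS exprS; ring.
pose B := \int[mu]_(t in turn) normc (p.[circle r t] / q (a :: s) t).
have bound k : normc (x k) <= 2 * r^-1 ^+ k * B.
  apply: normc_cint_le; first exact: cf.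
    apply: ccontM; first exact: ccont_horner.
    by apply: ccontV => // t; exact: q0.
  by move=> t; rewrite normcM normcX normcV normc_circle // ltW.
apply: eq0_normc; apply: (@geometric_majorant_eq0 _ (2 * r^-1 ^+ m * B)
    (normc a / r)).
- exact: normc_ge0.
- rewrite divr_ge0 ?normc_ge0 ?ltW //= ?ltr_pdivrMr ?mul1r //.
- move=> k; rewrite -/(x m) (iter k) normcM normcX.
  apply: (le_trans (ler_wpM2l _ (bound _))).
    by rewrite exprn_ge0 // normc_ge0.
  by rewrite exprMn exprD le_eqVlt; apply/orP; left; apply/eqP; ring.
Qed.

Lemma contour_int_quotient r (s : seq R[i]) (d p : {poly R[i]})
    (u : R[i] -> R[i]) : 0 < r ->
  all (fun a => normc a < r) s -> (size p <= size s)%N ->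
  (forall w, normc w = r ->
     u w = (d.[w] + p.[w] / \prod_(a <- s) (w - a)) / w) ->
  contour_int r u = 2 * pi%:C * 'i * d.[0].
Proof.
move=> r0 sr sp fE; have r1 : r != 0 by rewrite gt_eqF.
have cc := ccont_circle r.
have cf : ccont (fun t => p.[circle r t] / \prod_(a <- s) (circle r t - a)).
  apply: ccontM; first exact: ccont_horner.
  apply: ccontV; last first.
    by apply: ccont_prod => a; apply: ccontD => //; exact: ccont_cst.
  move=> t; rewrite prodf_seq_neq0; apply/allP => a /(allP sr) ar.
  exact: circle_sub_neq0.
rewrite -[LHS]/(cint (fun t => u (circle r t) * dcircle r t)).
rewrite (@eq_cint _ (fun t => 'i * (d.[circle r t] +
    p.[circle r t] / \prod_(a <- s) (circle r t - a)))); last first.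
  move=> t; rewrite fE ?normc_circle ?ltW //.
  have -> : dcircle r t = 'i * circle r t.
    by rewrite /dcircle /circle; simpc.
  by rewrite mulrCA -!mulrA mulVf ?circle_neq0 // mulr1.
rewrite cintZ; last by apply: ccontD => //; exact: ccont_horner.
rewrite cintD //; last exact: ccont_horner.
have := cint_proper_fraction r0 sr 0 sp.
under eq_fun do rewrite expr0 mul1r.
move=> ->; rewrite cint_horner addr0 rmorphM /= rmorph_nat; ring.
Qed.

End CircleMean.

(** * Values of reduced rational functions *)

Section ReducedValue.

Variables (F : fieldType) (m : nat).
Local Notation MP := (mpoly m F).
Local Notation X_ a := (mpolyX F (mnm1 a) : MP).
Implicit Types (p q d P Q : MP) (v : 'I_m -> F).

(** The quotient map modulo X_a - X_b, realized as a substitution; its kernel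
    being the ideal of X_a - X_b shows that this polynomial is prime. *)
Definition identify (a b : 'I_m) : MP -> MP :=
  comp_mpoly [tuple (if i == a then X_ b else X_ i) | i < m].

(** The polynomials congruent to their image modulo X_a - X_b form a subring
    that contains the constants and the variables. *)
Lemma identify_dvd a b p : exists g, p = (X_ a - X_ b) * g + identify a b p.
Proof.
rewrite /identify; set t := [tuple _ | _ < _].
pose good q := exists g, q = (X_ a - X_ b) * g + comp_mpoly t q.
have good1 : good 1 by exists 0; rewrite comp_mpoly1 mulr0 add0r.
have goodM q r : good q -> good r -> good (q * r).
  move=> [g Eg] [g' Eg']; exists (g * r + comp_mpoly t q * g').
  by rewrite rmorphM /= {1}Eg {1 2}Eg'; ring.
have goodX i : good (X_ i).
  rewrite /good comp_mpolyXU -tnth_nth tnth_mktuple.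
  have [->|_] := eqVneq i a; first by exists 1; ring.
  by exists 0; ring.
have goodXe i k : good (X_ i ^+ k).
  by elim: k => [|k IH]; rewrite ?expr0 // exprS; apply: goodM.
have goodm u : good (mpolyX F u).
  rewrite mpolyXE_id; elim/big_rec: _ => // i q _; exact: goodM.
elim/mpolyind: p => [|c u p _ _ [g Eg]].
  by exists 0; rewrite comp_mpoly0 mulr0 add0r.
have [g' Eg'] := goodm u.
exists (c *: g' + g); rewrite comp_mpolyD comp_mpolyZ {1}Eg' {1}Eg.
by rewrite mulrDr scalerDr scalerAr; ring.
Qed.

Lemma identify_sub a b : a != b -> identify a b (X_ a - X_ b) = 0.
Proof.
move=> ab; rewrite /identify comp_mpolyB !comp_mpolyXU -!tnth_nth !tnth_mktuple.
by rewrite eqxx eq_sym (negPf ab) subrr.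
Qed.

Lemma sub_var_neq0 a b : a != b -> X_ a - X_ b != 0.
Proof.
move=> ab; apply/eqP => /(congr1 (meval (fun i => (i == a)%:R))).
rewrite mevalB !mevalXU eqxx eq_sym (negPf ab) subr0 meval0 => /eqP.
by rewrite oner_eq0.
Qed.

Lemma sub_var_prime a b p q g : a != b -> p * q = (X_ a - X_ b) * g ->
  (exists p', p = (X_ a - X_ b) * p') \/ (exists q', q = (X_ a - X_ b) * q').
Proof.
move=> ab /(congr1 (identify a b)).
rewrite {1 2}/identify !rmorphM /= -!/(identify _ _ _) identify_sub // mul0r.
move/eqP; rewrite mulf_eq0 => /orP[] /eqP E; [left|right].
- by have [p' Ep] := identify_dvd a b p; exists p'; rewrite {1}Ep E addr0.
- by have [p' Ep] := identify_dvd a b q; exists p'; rewrite {1}Ep E addr0.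
Qed.

Lemma meval_unit v d : d \is a GRing.unit -> meval v d != 0.
Proof.
move=> du; apply/eqP => d0; have /(congr1 (meval v)) := mulrV du.
by rewrite rmorphM /= d0 mul0r rmorph1 => /eqP; rewrite eq_sym oner_eq0.
Qed.

(** Each prime factor of the denominator on the right divides P or q: in the
    first case it is cancelled with P, in the second it is moved into q, where
    it does not vanish at v.  In the end q divides p, and is a unit. *)
Lemma reduced_form_den v (s : seq ('I_m * 'I_m)) P p q :
  all (fun ab => ab.1 != ab.2) s ->
  (forall d p' q', p = d * p' -> q = d * q' -> d \is a GRing.unit) ->
  P * q = p * \prod_(ab <- s) (X_ ab.1 - X_ ab.2) ->
  meval v (\prod_(ab <- s) (X_ ab.1 - X_ ab.2)) != 0 -> meval v q != 0.
Proof.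
elim: s P q => [|[a b] s IH] P q /=.
  move=> _ cop; rewrite big_nil mulr1 => E _.
  apply: meval_unit; apply: (cop q P 1); rewrite ?mulr1 // -E; exact: mulrC.
case/andP=> ab al cop; rewrite big_cons /= => E.
rewrite rmorphM mulf_eq0 negb_or => /andP[v1 v2].
have E' : P * q = (X_ a - X_ b) * (p * \prod_(i <- s) (X_ i.1 - X_ i.2)).
  by rewrite E; ring.
have [[P' EP]|[q' Eq]] := sub_var_prime ab E'.
  apply: (IH P') => //; apply: (mulfI (sub_var_neq0 ab)).
  by rewrite -E' EP mulrA.
rewrite Eq rmorphM mulf_neq0 //; apply: (IH P) => //.
  by move=> d p' r Ep Er; apply: (cop d p' ((X_ a - X_ b) * r)); rewrite ?Eq ?Er //; ring.
by apply: (mulfI (sub_var_neq0 ab)); rewrite -E' Eq; ring.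
Qed.

(** Cancelling a common factor that is not a unit lowers the degree of the
    denominator. *)
Lemma reduced_form_exists P Q : Q != 0 ->
  exists pq : MP * MP, is_reduced_form (tofrac P / tofrac Q) pq.1 pq.2.
Proof.
elim: {Q}(msize Q) {-2}Q (leqnn (msize Q)) P => [|N IH] Q sQ P Q0.
  by move: sQ; rewrite leqn0 msize_poly_eq0 (negPf Q0).
have [cop|/existsNP[d /existsNP[p' /existsNP[q' /not_implyP[EP /not_implyP[EQ nu]]]]]] :=
  pselect (forall d p' q', P = d * p' -> Q = d * q' -> d \is a GRing.unit).
  by exists (P, Q).
move: Q0 sQ; rewrite EQ mulf_eq0 negb_or => /andP[d0 q0] sQ.
have := IH q' _ p' q0; rewrite EP !rmorphM /= -mulf_div divff ?tofrac_eq0 //.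
rewrite mul1r; apply.
have sd : (1 < msize d)%N.
  rewrite ltnNge; apply/negP => sd; apply: nu.
  move: d0; rewrite (msize1_polyC sd); set c := mcoeff _ _.
  rewrite mpolyC_eq0 => c0; apply/unitrP; exists (mpolyC m c^-1).
  by rewrite -!mpolyCM mulVf // mulfV.
by move: sQ; rewrite msizeM //; move: (msize d) (msize q') sd => x y; lia.
Qed.

Lemma reduced_value_eq v (s : seq ('I_m * 'I_m)) P Q f :
  all (fun ab => ab.1 != ab.2) s ->
  Q = \prod_(ab <- s) (X_ ab.1 - X_ ab.2) -> meval v Q != 0 ->
  f = tofrac P / tofrac Q -> reduced_value f v = meval v P / meval v Q.
Proof.
move=> al QE Qv fE.
have Q0 : Q != 0 by apply: contraNneq Qv => ->; rewrite meval0.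
rewrite /reduced_value; case: xgetP => [pq _ [q0 Ef cop]|none]; last first.
  have [pq Hpq] := reduced_form_exists P Q0.
  by have := none pq; rewrite fE.
have E : P * pq.2 = pq.1 * Q.
  apply/eqP; rewrite -tofrac_eq !rmorphM /=.
  by rewrite -eqr_div ?tofrac_eq0 // -fE Ef.
have qv : meval v pq.2 != 0.
  by apply: (reduced_form_den al cop (P := P)); rewrite -?QE.
by apply/eqP; rewrite eqr_div // -!rmorphM /= E.
Qed.

Lemma reduced_value0 v : reduced_value (0 : {fraction MP}) v = 0.
Proof.
rewrite /reduced_value; case: xgetP => [pq _ [q0 Ef _]|_] /=.
  suff -> : pq.1 = 0 by rewrite meval0 mul0r.
  have q1 : tofrac pq.2 != 0 by rewrite tofrac_eq0.
  apply/eqP; rewrite -tofrac_eq0.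
  by rewrite -(divfK q1 (tofrac pq.1)) -Ef mul0r.
by rewrite meval0 mul0r.
Qed.

End ReducedValue.

(** * Residues of Laurent polynomials *)

Section Residues.

Variable F : fieldType.
Implicit Types (S : {poly F}) (f : {fraction {poly F}}).

(** The fraction field is replaced by an arbitrary field into which the
    polynomials embed, so that unification never unfolds its construction. *)
Section Embedding.

Variables (K : fieldType) (phi : {rmorphism {poly F} -> K}).
Hypothesis phi_inj : injective phi.

(** After clearing denominators, 'X^T divides (S * 'X^s - A) * u, hence its
    first factor as u(0) is nonzero; the coefficient of 'X^(T - 1) in this
    factor is the difference of both sides. *)
Lemma principal_part_uniq S (N : nat) (p u : {poly F}) (a : seq F) :
  u.[0] != 0 ->
  phi S / phi 'X ^+ N.+1 =
    \sum_(k < size a) phi (a`_k)%:P / phi 'X ^+ k.+1 + phi p / phi u ->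
  a`_0 = S`_N.
Proof.
move=> u0; set s := size a => E.
pose T := (s + N.+1)%N.
pose A : {poly F} := \sum_(k < s) (a`_k)%:P * 'X ^+ (T - k.+1).
have phi0 q : q != 0 -> phi q != 0.
  by apply: contraNneq => q0; apply/eqP/phi_inj; rewrite rmorph0.
have X0 : phi 'X != 0 by rewrite phi0 ?polyX_eq0.
have un0 : phi u != 0.
  by apply: phi0; apply: contraNneq u0 => ->; rewrite horner0.
have EA : (S * 'X ^+ s - A) * u = p * 'X ^+ T.
  apply: phi_inj; rewrite !rmorphM rmorphB rmorphM !rmorphXn /=.
  have -> : phi S = (phi S / phi 'X ^+ N.+1) * phi 'X ^+ N.+1.
    by rewrite divfK ?expf_neq0.
  rewrite E -[X in X - _]mulrA -exprD (addnC N.+1) -/T.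
  have -> : phi A = (\sum_(k < s) phi (a`_k)%:P / phi 'X ^+ k.+1)
                        * phi 'X ^+ T.
    rewrite /A rmorph_sum mulr_suml; apply: eq_bigr => k _.
    rewrite rmorphM rmorphXn /= -mulrA; congr (_ * _).
    apply: (mulfI (expf_neq0 k.+1 X0)).
    rewrite mulrA mulfV ?expf_neq0 // mul1r -exprD subnKC // /T.
    exact: ltn_addr.
  by rewrite -mulrBl addrAC subrr add0r mulrAC divfK.
have cop : coprimep ('X ^+ T) u.
  rewrite coprimep_expl // coprimep_sym; have := coprimep_XsubC u 0.
  by rewrite subr0 => ->.
have XT : 'X ^+ T %| S * 'X ^+ s - A.
  by rewrite -(Gauss_dvdpl (S * 'X ^+ s - A) cop) EA dvdp_mull.
have /eqP : (S * 'X ^+ s - A)`_(T.-1) = 0.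
  by case/dvdpP: XT => g ->; rewrite coefMXn /T addnS /= ltnSn.
rewrite coefB subr_eq0 => /eqP; rewrite coefMXn /T addnS /= ltnNge leq_addr /=.
rewrite addKn => ->; rewrite /A coef_sum /T.
case: (posnP s) => [s0|s_gt0].
  rewrite s0 big_ord0 nth_default //; first by rewrite -/s s0.
rewrite (bigD1 (Ordinal s_gt0)) //= big1 ?addr0.
  by rewrite coefCM coefXn addnS subn1 eqxx mulr1.
move=> k k0; rewrite coefCM coefXn addnS subSS.
case: eqP => [e|]; last by rewrite mulr0.
case/eqP: k0; apply/val_inj => /=; have := ltn_ord k; move: (val k) e => x; lia.
Qed.

Lemma principal_part_polyX S (N : nat) :
  phi S / phi 'X ^+ N.+1 =
    \sum_(k < N.+1) phi (S`_(N - k))%:P / phi 'X ^+ k.+1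
      + phi (drop_poly N.+1 S) / phi 1.
Proof.
have X0 : phi 'X != 0 by rewrite -(rmorph0 phi) (inj_eq phi_inj) polyX_eq0.
rewrite rmorph1 divr1 -{1}(poly_take_drop N.+1 S).
rewrite rmorphD rmorphM rmorphXn /= mulrDl mulfK ?expf_neq0 //; congr (_ + _).
rewrite /take_poly poly_def rmorph_sum mulr_suml (reindex_inj rev_ord_inj) /=.
apply: eq_bigr => k _; rewrite subSS -mul_polyC rmorphM rmorphXn /=.
rewrite -mulrA; congr (_ * _).
apply: (mulIf (expf_neq0 N.+1 X0)); rewrite divfK ?expf_neq0 //.
apply: (mulfI (expf_neq0 k.+1 X0)).
rewrite mulrA mulfV ?expf_neq0 // mul1r -exprD; congr (_ ^+ _).
by have := ltn_ord k; lia.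
Qed.

End Embedding.

Lemma residue0_polyX S (N : nat) :
  residue0 (tofrac S / tofrac 'X ^+ N.+1) = S`_N.
Proof.
have inj : injective (@tofrac {poly F}) by move=> p q /eqP; rewrite tofrac_eq => /eqP.
rewrite /residue0; case: xgetP => [c _ [a [p [u [u0 E]]] ->]|none].
  exact: (principal_part_uniq inj u0 E).
case: (none S`_N); exists (mkseq (fun k => S`_(N - k)) N.+1); last first.
  by rewrite nth_mkseq // subn0.
exists (drop_poly N.+1 S), 1; split; first by rewrite hornerC oner_eq0.
rewrite (principal_part_polyX inj) size_mkseq; congr (_ + _).
by apply: eq_bigr => k _; rewrite nth_mkseq.
Qed.

End Residues.

(** * Weight functions at the fixed points *)

Section Pairs.

Variable n : nat.
Implicit Types (a b c : 'I_n) (I : {set 'I_n}).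

Lemma enum_pair a b : (a < b)%N -> enum [set a; b] = [:: a; b].
Proof.
move=> ab; apply: (@irr_sorted_eq _ (fun c d : 'I_n => (c < d)%N)).
- by move=> x y z; exact: ltn_trans.
- by move=> x; exact: ltnn.
- rewrite /enum_mem; apply: sorted_filter; first by move=> x y z; exact: ltn_trans.
  have := iota_ltn_sorted 0 n.
  by rewrite -val_enum_ord sorted_map -enumT.
- by rewrite /= ab.
- by move=> x; rewrite mem_enum !inE.
Qed.

Lemma elem_pair0 a b : (a < b)%N -> elem [set a; b] 0 = a.+1.
Proof. by move=> ab; rewrite /elem /labels enum_pair. Qed.

Lemma elem_pair1 a b : (a < b)%N -> elem [set a; b] 1 = b.+1.
Proof. by move=> ab; rewrite /elem /labels enum_pair. Qed.

Lemma pairP I : #|I| = 2%N -> exists a b, (a < b)%N /\ I = [set a; b].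
Proof.
move/eqP/cards2P => [a [b [ab ->]]].
have [lt|gt|/val_inj e] := ltngtP (a : nat) b.
- by exists a, b.
- by exists b, a; rewrite finset.setUC.
- by rewrite e eqxx in ab.
Qed.

Lemma labelsE I (m : nat) :
  reflect (exists2 a, a \in I & m = a.+1) (m \in labels I).
Proof.
apply: (iffP mapP) => -[a aI ->]; exists a => //; by rewrite mem_enum in aI *.
Qed.

End Pairs.

Lemma big_perm2 (V : nmodType) (f : {perm 'I_2} -> V) :
  \sum_p f p = f 1%g + f (tperm ord0 ord_max).
Proof.
rewrite (bigD1 1%g) //= (bigD1 (tperm ord0 ord_max)) /=; last first.
  apply/eqP => /permP/(_ ord0); rewrite tpermL perm1 => /(congr1 val) //.
rewrite big1 ?addr0 // => p /andP[p1 pt].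
have [p0|p0] : p ord0 = ord0 \/ p ord0 = ord_max.
- by case: (p ord0) => -[|[|//]] k; [left|right]; apply: val_inj.
- case/eqP: p1; apply/permP => x; rewrite perm1.
  have pm : p ord_max != ord0 by rewrite -p0 (inj_eq perm_inj).
  case: x => -[|[|//]] k.
    by rewrite (_ : Ordinal k = ord0) //; apply: val_inj.
  rewrite (_ : Ordinal k = ord_max); last exact: val_inj.
  case: (p ord_max) pm => -[|[|//]] k' //.
  by move=> _; apply: val_inj.
- case/eqP: pt; apply/permP => x.
  have pm : p ord_max != ord_max by rewrite -[X in _ != X]p0 (inj_eq perm_inj).
  case: x => -[|[|//]] k.
    by rewrite (_ : Ordinal k = ord0) ?tpermL //; apply: val_inj.
  rewrite (_ : Ordinal k = ord_max) ?tpermR; last exact: val_inj.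
  case: (p ord_max) pm => -[|[|//]] k' //.
  by move=> _; apply: val_inj.
Qed.

Definition others (N : nat) (l c : 'I_N.+1) := (c != ord_max) && (c != l).

Section WeightsInField.

Variables (E : fieldType) (N : nat) (z : 'I_N.+1 -> E) (h : E).
Implicit Types (a b c i j k l : 'I_N.+1) (t x : E).

(** [step] is the function Psi for one element a of the set; [costep] is the
    one for a permuted by s_0, where the order of the labels is reversed. *)
Definition step a c x : E :=
  if (c < a)%N then x + h else if c == a then h else x.

Definition costep a c x : E :=
  if (a < c)%N then x + h else if c == a then h else x.

(** The two diagonal factors t_a - t_a + h of the last denominator are h. *)
Definition pairU a b t0 t1 (y : 'I_N.+1 -> E) : E :=
  (\prod_c step a c (y c - t0)) * (\prod_c step b c (y c - t1))
  / ((t1 - t0) * (h * (t0 - t1 + h) * h)).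

Lemma weightU_pair a b (t : 'I_2 -> E) y : (a < b)%N ->
  weightU [set a; b] t y h = pairU a b (t ord0) (t ord_max) y.
Proof.
move=> ab; rewrite /weightU /pairU.
have PsiE (e : 'I_2) c x : Psi [set a; b] e c h x =
    step (if e == ord0 then a else b) c x.
  rewrite /Psi /step; case: e => -[|[|//]] k /=.
    by rewrite elem_pair0 // ltnS eqSS.
  by rewrite elem_pair1 // ltnS eqSS.
have two (P : pred 'I_2) (f : 'I_2 -> E) : \prod_(e < 2 | P e) f e =
    (if P ord0 then f ord0 else 1) * (if P ord_max then f ord_max else 1).
  rewrite big_mkcond !big_ord_recl big_ord0 /= mulr1.
  by rewrite (_ : lift ord0 ord0 = ord_max) //; apply: val_inj.
have prE (e : 'I_2) x : \prod_c Psi [set a; b] e c h (y c - x) =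
    \prod_c step (if e == ord0 then a else b) c (y c - x).
  by apply: eq_bigr => c _; exact: PsiE.
rewrite !two /= !prE /=.
rewrite !mul1r !mulr1 -!mulrA; congr (_ * (_ * _)).
by rewrite !subrr !add0r !invfM; ring.
Qed.

Lemma weightW_pair (s : {perm 'I_N.+1}) (I : {set 'I_N.+1}) a b
    (t : 'I_2 -> E) : (a < b)%N ->
  s @^-1: I = [set a; b] ->
  weightW s I t z h = pairU a b (t ord0) (t ord_max) (z \o s)
                      + pairU a b (t ord_max) (t ord0) (z \o s).
Proof.
move=> ab sI; rewrite /weightW sI big_perm2 !weightU_pair //.
by rewrite !perm1 tpermL tpermR.
Qed.


Lemma restrict_pair l j : (l < j)%N ->
  (Defs.restrict [set l; j] z ord0 = z l) * (Defs.restrict [set l; j] z ord_max = z j).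
Proof. by move=> lj; rewrite /Defs.restrict enum_pair. Qed.

Lemma prod_step_eq0 a c (y : 'I_N.+1 -> E) : (a < c)%N ->
  \prod_b step a b (y b - y c) = 0.
Proof.
move=> ac; rewrite (bigD1 c) //= subrr /step ltnNge ltnW //=.
by rewrite -(inj_eq val_inj) /= gtn_eqF ?mul0r.
Qed.

Lemma s0_preim k : (s0 N.+1) @^-1: [set k; ord_max] = [set ord0; rev_ord k].
Proof.
apply/setP => c; rewrite !inE permE orbC; congr orb.
- rewrite -(inj_eq rev_ord_inj) rev_ordK; congr (_ == _).
  by apply: val_inj; rewrite /= subSS subnn.
- by rewrite -(inj_eq rev_ord_inj) rev_ordK.
Qed.

Lemma step_rev k c x : step (rev_ord k) (rev_ord c) x = costep k c x.
Proof.
rewrite /step /costep (inj_eq rev_ord_inj) /=.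
congr (if _ then _ else _); have := ltn_ord k; have := ltn_ord c; lia.
Qed.


Lemma prod_others l (f : 'I_N.+1 -> E) : (l < N)%N ->
  \prod_c f c = f ord_max * (f l * \prod_(c | others l c) f c).
Proof.
move=> lN; rewrite (bigD1 ord_max) //= (bigD1 l) //=.
by apply/eqP => /(congr1 val) /= e; rewrite e ltnn in lN.
Qed.

(** After the permutation by s_0 the element n of K becomes the first label,
    and its step vanishes at every z_c with c other than n: both terms of the
    symmetrization are 0 when n is not in L. *)
Lemma weightW_s0_eq0 k l j : (k < N)%N -> (l < j)%N -> (j < N)%N ->
  weightW (s0 N.+1) [set k; ord_max] (Defs.restrict [set l; j] z) z h = 0.
Proof.
move=> kN lj jN; have k0 : (@ord0 N < rev_ord k)%N by rewrite /= subSS subn_gt0.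
rewrite (weightW_pair _ k0 (s0_preim k)) !restrict_pair // /pairU.
have s0r c : z c = (z \o s0 N.+1) (rev_ord c) by rewrite /= permE rev_ordK.
rewrite (s0r l) (s0r j) !(@prod_step_eq0 ord0) ?mul0r ?addr0 //=; lia.
Qed.

Hypothesis h0 : h != 0.
Hypothesis z_inj : forall a b, a != b -> z a - z b != 0.
Hypothesis z_sep : forall a b, a != b -> z a - z b + h != 0.

(** Only the term with t_1 = z_n survives.  The factors at c = l and c = n
    of its two products cancel the denominators if k <= l; otherwise the one
    at c = l in the second product is 0. *)
Lemma weightW_s0 k l : (k < N)%N -> (l < N)%N ->
  weightW (s0 N.+1) [set k; ord_max] (Defs.restrict [set l; ord_max] z) z h =
  if (k <= l)%N then
    \prod_(c | others l c) ((z c - z ord_max) * costep k c (z c - z l))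
  else 0.
Proof.
move=> kN lN; have k0 : (@ord0 N < rev_ord k)%N by rewrite /= subSS subn_gt0.
rewrite (weightW_pair _ k0 (s0_preim k)) !restrict_pair // /pairU.
have s0r c : z c = (z \o s0 N.+1) (rev_ord c) by rewrite /= permE rev_ordK.
rewrite {1}(s0r l) prod_step_eq0 ?mul0r ?add0r; last by rewrite /=; lia.
have E1 t a : \prod_c step (rev_ord a) c ((z \o s0 N.+1) c - t) =
    \prod_c costep a c (z c - t).
  rewrite (reindex_inj rev_ord_inj); apply: eq_bigr => c _.
  by rewrite step_rev -s0r.
have E2 t : \prod_c step ord0 c ((z \o s0 N.+1) c - t) =
    \prod_c costep ord_max c (z c - t).
  rewrite (reindex_inj rev_ord_inj); apply: eq_bigr => c _.
  by rewrite -s0r -step_rev; congr step; apply: val_inj; rewrite /= subSS subnn.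
rewrite E1 E2 !(prod_others _ lN) !subrr.
have lm : l != ord_max by apply/eqP => e; rewrite e ltnn in lN.
have -> : costep ord_max ord_max 0 = h by rewrite /costep ltnn eqxx.
have -> : costep ord_max l (z l - z ord_max) = z l - z ord_max.
  by rewrite /costep /= ltnNge (ltnW lN) (negPf lm).
have -> : costep k ord_max (z ord_max - z l) = z ord_max - z l + h.
  by rewrite /costep /= kN.
have -> : costep k l 0 = if (k <= l)%N then h else 0.
  by rewrite /costep add0r -(inj_eq val_inj) /=; case: (ltngtP k l).
have -> : \prod_(c | others l c) costep ord_max c (z c - z ord_max) =
    \prod_(c | others l c) (z c - z ord_max).
  apply: eq_bigr => c /andP[cm _].
  by rewrite /costep (negPf cm) /= ltnNge -ltnS ltn_ord.
case: ifP => _; last by rewrite !(mul0r, mulr0).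
have lm' : ord_max != l by rewrite eq_sym.
rewrite big_split /=; field.
by rewrite h0 z_inj // z_sep.
Qed.

(** Here the term with t_1 = z_n vanishes, because its factor at c = n does. *)
Lemma weightW_id i l : (i < N)%N -> (l < N)%N ->
  weightW 1%g [set i; ord_max] (Defs.restrict [set l; ord_max] z) z h =
  if (l <= i)%N then
    \prod_(c | others l c) ((z c - z ord_max + h) * step i c (z c - z l))
  else 0.
Proof.
move=> iN lN; rewrite (@weightW_pair _ _ i ord_max) //; last first.
  by apply/setP => c; rewrite !inE perm1.
rewrite !restrict_pair // /pairU.
have E1 t a : \prod_c step a c ((z \o (1%g : {perm 'I_N.+1})) c - t) =
    \prod_c step a c (z c - t).
  by apply: eq_bigr => c _; rewrite /= perm1.
rewrite !E1 [X in _ + X / _]mulrC (@prod_step_eq0 i ord_max) // mulr0 mul0r addr0.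
rewrite !(prod_others _ lN) !subrr.
have lm : l != ord_max by apply/eqP => e; rewrite e ltnn in lN.
have lm' : ord_max != l by rewrite eq_sym.
have im : ord_max != i by apply/eqP => e; rewrite -e ltnn in iN.
have -> : step ord_max ord_max 0 = h by rewrite /step ltnn eqxx.
have -> : step ord_max l (z l - z ord_max) = z l - z ord_max + h.
  by rewrite /step /= lN.
have -> : step i ord_max (z ord_max - z l) = z ord_max - z l.
  by rewrite /step /= ltnNge (ltnW iN) (negPf im).
have -> : step i l 0 = if (l <= i)%N then h else 0.
  by rewrite /step add0r -(inj_eq val_inj) /=; case: (ltngtP l i).
have -> : \prod_(c | others l c) step ord_max c (z c - z ord_max) =
    \prod_(c | others l c) (z c - z ord_max + h).
  apply: eq_bigr => c /andP[cm _]; rewrite /step /=.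
  have := ltn_ord c; rewrite ltnS leq_eqVlt; move: cm.
  by rewrite -(inj_eq val_inj) /= => /negPf -> /= ->.
case: ifP => _; last by rewrite !(mul0r, mulr0).
rewrite big_split /=; field.
by rewrite h0 z_inj // z_sep.
Qed.

Lemma chat_prod i j k l : (i < N)%N -> (j < N)%N -> (k < N)%N -> (l < N)%N ->
  chat [set i; ord_max] [set j; ord_max] [set k; ord_max] [set l; ord_max] z h =
  if [&& k <= l, l <= i & l <= j]%N then
    \prod_(c | others l c)
      ((z c - z ord_max + h) *
       (step i c (z c - z l) * step j c (z c - z l) * costep k c (z c - z l)
        / ((z c - z l) * (z c - z l + h))))
  else 0.
Proof.
move=> iN jN kN lN; rewrite /chat weightW_s0 // !weightW_id //.
case: (leqP k l) => kl; last by rewrite !(mulr0, mul0r).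
case: (leqP l i) => li; last by rewrite !(mulr0, mul0r).
case: (leqP l j) => lj; last by rewrite !(mulr0, mul0r).
have lm : l != ord_max by apply/eqP => e; rewrite e ltnn in lN.
have RE (f : 'I_N.+1 -> 'I_N.+1 -> E) :
    \prod_(a in [set l; ord_max]) \prod_(b in ~: [set l; ord_max]) f a b =
    \prod_(c | others l c) (f l c * f ord_max c).
  rewrite big_setU1 ?inE //= big_set1 -big_split /=; apply: eq_bigl => c.
  by rewrite !inE negb_or andbC.
rewrite /R_ /Q_ !RE -!big_split -prodf_div; apply: eq_bigr => c /andP[cm cl] /=.
by field; rewrite !z_inj // !z_sep.
Qed.

Lemma chat_eq0 (I J : {set 'I_N.+1}) k l (m : 'I_N.+1) :
  (k < N)%N -> (l < m)%N -> (m < N)%N ->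
  chat I J [set k; ord_max] [set l; m] z h = 0.
Proof.
by move=> kN lm mN; rewrite /chat weightW_s0_eq0 // mulr0 mul0r.
Qed.

End WeightsInField.

(** * The reduced form of chat *)

Section LocalFactors.

Variables (A : comNzRingType) (i j k : nat).
Implicit Types (c : nat) (u h : A).

(** For u = z_c - z_l, the numerator left in the factor of label c once
    u (u + h) is cancelled against the three steps; [den] is what remains of
    the denominator.  The definition is over any ring, to be evaluated both at
    polynomials and at complex numbers. *)
Definition num c u h : A :=
  if (c < k)%N then u + h
  else if (c <= i)%N then
    if c == k then h * (u + h)
    else if (c < i)%N then (u + h) ^+ 2
    else if i == j then h ^+ 2 else h * (u + h)
  else if (c < j)%N then u + h else if c == j then h else u.

Definition den c u : A := if (k <= c <= i)%N then u else 1.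

End LocalFactors.

Lemma rmorph_num (A B : comNzRingType) (phi : {rmorphism A -> B}) i j k c u h :
  phi (num i j k c u h) = num i j k c (phi u) (phi h).
Proof.
by rewrite /num; do ![case: ifP => _]; rewrite ?(rmorphM, rmorphXn, rmorphD) //=.
Qed.

Lemma rmorph_den (A B : comNzRingType) (phi : {rmorphism A -> B}) i k c u :
  phi (den i k c u) = den i k c (phi u).
Proof. by rewrite /den; case: ifP => _ //; rewrite rmorph1. Qed.

Lemma step_num (E : fieldType) (N : nat) (i j k l c : 'I_N.+1) (u h : E) :
  (k <= l)%N -> (l <= i)%N -> (i <= j)%N -> c != l -> u != 0 -> u + h != 0 ->
  step h i c u * step h j c u * costep h k c u / (u * (u + h)) =
  num i j k c u h / den i k c u.
Proof.
move=> kl li ij; rewrite -(inj_eq val_inj) /= => cl u0 uh0.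
rewrite /step /costep /num /den -!(inj_eq val_inj) /=.
move: (val i) (val j) (val k) (val l) (val c) kl li ij cl => {}i {}j {}k {}l {}c.
move=> kl li ij cl; have uu0 : u * (u + h) != 0 by rewrite mulf_neq0.
have [ck|ck|ck] := ltngtP c k.
- have [-> ->] : (c < i)%N = true /\ (c < j)%N = true by split; lia.
  by apply: (mulIf uu0); rewrite divfK // divr1; ring.
- have [ci|ci|ci] := ltngtP c i.
  + have -> : (c < j)%N = true by lia.
    by rewrite /= ?divr1; field; rewrite ?u0 ?uh0.
  + have [cj|cj|cj] := ltngtP c j; rewrite /= ?divr1; field; by rewrite ?u0 ?uh0.
  + by have [cj|cj|cj] := ltngtP c j; have [ij'|ij'|ij'] := ltngtP i j; try lia;
      rewrite /=; field; rewrite ?u0 ?uh0.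
- have [ci cj] : (i < c)%N = false /\ (j < c)%N = false by split; lia.
  have [ci' [cj' ->]] : (c < i)%N /\ (c < j)%N /\ (c <= i)%N = true.
    by split; [|split]; lia.
  by rewrite ci' cj' /=; field; rewrite ?u0 ?uh0.
Qed.

(** Stated for a morphism into an abstract field: applied to the embedding in
    the field of rational functions, it exhibits chat as a quotient of two
    polynomials. *)
Lemma chat_morph (A : comNzRingType) (E : fieldType) (phi : {rmorphism A -> E})
    (N : nat) (z : 'I_N.+1 -> A) (h : A) (i j k l : 'I_N.+1) :
  phi h != 0 -> (forall a b, a != b -> phi (z a) - phi (z b) != 0) ->
  (forall a b, a != b -> phi (z a) - phi (z b) + phi h != 0) ->
  (k <= l)%N -> (l <= i)%N -> (i <= j)%N -> (j < N)%N ->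
  chat [set i; ord_max] [set j; ord_max] [set k; ord_max] [set l; ord_max]
    (fun b => phi (z b)) (phi h) =
  phi (\prod_(c | others l c)
         ((z c - z ord_max + h) * num i j k c (z c - z l) h)) /
  phi (\prod_(c | others l c) den i k c (z c - z l)).
Proof.
move=> h0 z0 zh kl li ij jN.
have [iN lN kN] : [/\ i < N, l < N & k < N]%N by split; lia.
rewrite (chat_prod h0 z0 zh) // kl li (leq_trans li ij) /= !rmorph_prod.
rewrite -prodf_div; apply: eq_bigr => c /andP[cm cl].
rewrite (step_num kl li ij cl) ?z0 ?zh // mulrA rmorphM rmorphD.
by rewrite rmorph_num rmorph_den !rmorphB.
Qed.

Section ChatRat.

Variables (F : fieldType) (N : nat).
Implicit Types (z : 'I_N.+1 -> F) (h : F) (i j k l : 'I_N.+1).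

Lemma point_z z h (c : 'I_N.+1) : Defs.point z h (widen_ord (leqnSn N.+1) c) = z c.
Proof.
rewrite /Defs.point; case: unliftP => [b /(congr1 val) /= e|/(congr1 val) /= e].
  congr z; apply: val_inj => /=; rewrite e /bump.
  by rewrite leqNgt ltn_ord.
by have := ltn_ord c; rewrite e ltnn.
Qed.

Lemma point_h z h : Defs.point z h ord_max = h.
Proof. by rewrite /Defs.point unlift_none. Qed.

Let wide (c : 'I_N.+1) := widen_ord (leqnSn N.+1) c.
Let X_ (c : 'I_N.+1) : mpoly N.+2 F := mpolyX F (mnm1 (wide c)).
Let H_ : mpoly N.+2 F := mpolyX F (mnm1 (ord_max : 'I_N.+2)).

Let wide_inj : injective wide.
Proof. by move=> a b /(congr1 val) /= /val_inj. Qed.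

Let wide_max c : wide c != ord_max.
Proof. by apply/eqP => /(congr1 val) /= e; have := ltn_ord c; rewrite e ltnn. Qed.

Let hvar_neq0 : hvar F N.+1 != 0.
Proof.
rewrite tofrac_eq0; apply/eqP => /(congr1 (meval (fun=> 1))).
by rewrite mevalXU meval0 => /eqP; rewrite oner_eq0.
Qed.

Let zvar_inj a b : a != b -> @zvar F N.+1 a - @zvar F N.+1 b != 0.
Proof.
by move=> ab; rewrite -rmorphB tofrac_eq0 sub_var_neq0 // (inj_eq wide_inj).
Qed.

Let zvar_sep a b : a != b -> @zvar F N.+1 a - @zvar F N.+1 b + hvar F N.+1 != 0.
Proof.
move=> ab; rewrite -rmorphB -rmorphD tofrac_eq0; apply/eqP.
move=> /(congr1 (meval (fun c => (c == wide a)%:R))).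
rewrite mevalD mevalB !mevalXU meval0 eqxx !(eq_sym _ (wide a)).
rewrite (negPf (wide_max a)) (inj_eq wide_inj) (negPf ab) subr0 addr0.
by move/eqP; rewrite oner_eq0.
Qed.

Lemma chat_rat_eq0 (i j k : 'I_N.+1) (L : {set 'I_N.+1}) :
  (i < N)%N -> (j < N)%N -> (k < N)%N -> #|L| = 2%N ->
  ~~ [&& (ord_max \in L), (k.+1 <= elem L 0)%N,
         (elem L 0 <= i.+1)%N & (elem L 0 <= j.+1)%N] ->
  chat_rat F [set i; ord_max] [set j; ord_max] [set k; ord_max] L = 0.
Proof.
move=> iN jN kN /pairP[l [m [lm ->]]]; rewrite elem_pair0 // !inE !ltnS /chat_rat.
have lN : (l < N)%N by have := ltn_ord m; lia.
have [<-|mm] := eqVneq ord_max m; last first.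
  move=> _; rewrite chat_eq0 //; have := ltn_ord m.
  by rewrite ltnS leq_eqVlt; move: mm; rewrite eq_sym -(inj_eq val_inj) /= => /negPf ->.
rewrite orbT /= => cond.
by rewrite (chat_prod hvar_neq0 zvar_inj zvar_sep iN jN kN lN) (negPf cond).
Qed.

Lemma reduced_chat (i j k l : 'I_N.+1) z h :
  (k <= l)%N -> (l <= i)%N -> (i <= j)%N -> (j < N)%N -> injective z ->
  reduced_value (chat_rat F [set i; ord_max] [set j; ord_max]
                   [set k; ord_max] [set l; ord_max]) (Defs.point z h) =
  \prod_(c | others l c) ((z c - z ord_max + h) * num i j k c (z c - z l) h
                          / den i k c (z c - z l)).
Proof.
move=> kl li ij jN zi.
pose P : mpoly N.+2 F :=
  \prod_(c | others l c) ((X_ c - X_ ord_max + H_) * num i j k c (X_ c - X_ l) H_).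
pose Q : mpoly N.+2 F := \prod_(c | others l c) den i k c (X_ c - X_ l).
pose s := [seq (wide c, wide l) |
           c <- enum 'I_N.+1 & others l c && (k <= c <= i)%N].
have chatE : chat_rat F [set i; ord_max] [set j; ord_max]
               [set k; ord_max] [set l; ord_max] = tofrac P / tofrac Q.
  exact (@chat_morph _ _ (@tofrac (mpoly N.+2 F)) N X_ H_ i j k l
           hvar_neq0 zvar_inj zvar_sep kl li ij jN).
have zl c : c != l -> z c - z l != 0 by rewrite subr_eq0 (inj_eq zi).
have QE : meval (Defs.point z h) Q = \prod_(c | others l c) den i k c (z c - z l).
  rewrite rmorph_prod; apply: eq_bigr => c _; rewrite rmorph_den rmorphB /=.
  by rewrite !mevalXU !point_z.
rewrite (@reduced_value_eq _ _ _ s P Q) //.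
- rewrite QE rmorph_prod -prodf_div; apply: eq_bigr => c _.
  rewrite rmorphM rmorph_num rmorphD !rmorphB /= !mevalXU !point_z point_h //.
- apply/allP => _ /mapP[c + ->] /=; rewrite mem_filter => /andP[/andP[/andP[_ cl] _] _].
  by rewrite (inj_eq wide_inj).
- rewrite /Q /s big_map big_filter big_enum_cond [LHS]big_mkcond [RHS]big_mkcond.
  by apply: eq_bigr => c _; rewrite /den inE /=; case: (others l c).
- rewrite QE; apply/prodf_neq0 => c /andP[_ cl]; rewrite /den.
  by case: ifP; rewrite ?zl ?oner_eq0.
Qed.

End ChatRat.

(** * Iterated means over the torus *)

Section IteratedMeans.

Variables (R : realType) (n : nat).
Local Notation C := R[i].
Implicit Types (z : 'I_n -> C) (b c : 'I_n) (s : seq 'I_n).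

Local Notation radius b := ((val b).+2%:R^-1 : R).
Local Notation upd z b w := (fun b' => if b' == b then w else z b').

Lemma eq_contour_int r (f g : C -> C) : 0 <= r ->
  (forall w, normc w = r -> f w = g w) -> contour_int r f = contour_int r g.
Proof.
move=> r0 fg; have e t : f (circle r t) * dcircle r t = g (circle r t) * dcircle r t.
  by rewrite fg // normc_circle.
by congr (_ +i* _); apply: eq_Rintegral => t _; rewrite e.
Qed.

(** [T] collects the variables already bound by the outer integrals. *)
Lemma eq_iter_int (T s : seq 'I_n) (f g : ('I_n -> C) -> C) z :
  (forall b, b \in T -> normc (z b) = radius b) ->
  (forall z', (forall b, b \in T ++ s -> normc (z' b) = radius b) ->
     f z' = g z') ->
  iter_int s f z = iter_int s g z.
Proof.
elim: s T z => [|b s IH] T z zT fg /=; first by apply: fg; rewrite cats0.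
apply: eq_contour_int => [|w wr]; first by rewrite invr_ge0.
apply: (IH (b :: T)) => [b'|z' z'T].
  by rewrite inE; case: eqVneq => [-> //|_] /= /zT.
by apply: fg => b'; rewrite mem_cat inE orbCA -mem_cat -in_cons; exact: z'T.
Qed.

Lemma iter_int_rcons s b (f : ('I_n -> C) -> C) z :
  iter_int (rcons s b) f z =
  iter_int s (fun z' => contour_int (radius b) (fun w => f (upd z' b w))) z.
Proof.
elim: s z => [//|c s IH] z /=; congr contour_int.
by apply: boolp.funext => w; exact: IH.
Qed.

(** The variables not yet integrated after m steps, outermost first. *)
Let rest m := rev (drop m (enum 'I_n)).

Lemma rest_rcons b : rest b = rcons (rest b.+1) b.
Proof.
rewrite /rest (drop_nth b); last by rewrite size_enum_ord ltn_ord.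
by rewrite nth_ord_enum rev_cons.
Qed.

Lemma mem_rest m b : (b \in rest m) = (m <= b)%N.
Proof.
rewrite mem_rev; apply/idP/idP => [|mb].
  move=> /(nthP b)[c]; rewrite size_drop size_enum_ord nth_drop => cn <-.
  by rewrite nth_enum_ord ?leq_addr //; lia.
apply/(nthP b); exists (b - m)%N.
  by rewrite size_drop size_enum_ord; have := ltn_ord b; lia.
by rewrite nth_drop subnKC // nth_ord_enum.
Qed.

(** The situation of [contour_int_quotient] for the variable z_b of G, with v
    the resulting mean. *)
Definition quotient_step (G : ('I_n -> C) -> C) b z (v : C) :=
  exists (s : seq C) (d p : {poly C}),
    [/\ all (fun a => normc a < radius b) s, (size p <= size s)%N,
        forall w, normc w = radius b ->
          G (upd z b w) = d.[w] + p.[w] / \prod_(a <- s) (w - a) & d.[0] = v].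

(** Integration goes from the innermost variable outwards; G m is the mean
    over the first m variables, as a function of the others. *)
Lemma iter_int_mean (G : nat -> ('I_n -> C) -> C) z :
  (forall b z', (forall c, (b < c)%N -> normc (z' c) = radius c) ->
     quotient_step (G b) b z' (G b.+1 z')) ->
  iter_int (rev (enum 'I_n)) (fun z' => G 0%N z' / \prod_c z' c) z =
  (2 * pi%:C * 'i) ^+ n * G n z.
Proof.
move=> step; pose H m z' := (2 * pi%:C * 'i) ^+ m *
  (G m z' / \prod_(c : 'I_n | (m <= c)%N) z' c).
have stepH b z' : (forall c, (b < c)%N -> normc (z' c) = radius c) ->
    contour_int (radius b) (fun w => H b (upd z' b w)) = H b.+1 z'.
  move=> z'r; have [s [d [p [sr sp GE d0]]]] := step b z' z'r.
  pose q := (2 * pi%:C * 'i) ^+ b / \prod_(c : 'I_n | (b < c)%N) z' c.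
  rewrite (@contour_int_quotient _ (radius b) s (q *: d) (q *: p)) //.
  - by rewrite hornerZ d0 /H /q exprS; ring.
  - exact: leq_trans (size_scale_leq _ _) sp.
  move=> w wr; rewrite /H GE // (bigD1 b) //= eqxx.
  rewrite [X in _ / (w * X)](_ : _ = \prod_(c : 'I_n | (b < c)%N) z' c); last first.
    apply: eq_big => [c|c /andP[_ /negPf ->] //].
    by rewrite ltn_neqAle andbC (eq_sym c) (inj_eq val_inj).
  by rewrite !hornerZ /q invfM; ring.
have main m : (m <= n)%N ->
    iter_int (rev (enum 'I_n)) (H 0%N) z = iter_int (rest m) (H m) z.
  elim: m => [|m IH] mn; first by rewrite /rest drop0.
  rewrite IH ?(ltnW mn) // -[m]/(val (Ordinal mn)) rest_rcons iter_int_rcons.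
  apply: (@eq_iter_int [::]) => // z' z'r; apply: stepH => c mc.
  by apply: z'r; rewrite mem_rest.
have -> : (fun z' => G 0%N z' / \prod_c z' c) = H 0%N.
  by apply: boolp.funext => z'; rewrite /H expr0 mul1r; congr (_ / _); apply: eq_bigl.
rewrite (main n) // /rest drop_oversize ?size_enum_ord //= /H.
by rewrite big_pred0 ?divr1 // => c; rewrite leqNgt ltn_ord.
Qed.

Lemma meval_upd_horner (p : mpoly n C) b z :
  exists d : {poly C}, forall w, meval (upd z b w) p = d.[w].
Proof.
pose good q := exists d : {poly C}, forall w, meval (upd z b w) q = d.[w].
have goodM q r : good q -> good r -> good (q * r).
  by move=> [d dE] [e eE]; exists (d * e) => w; rewrite mevalM dE eE hornerM.
have goodX c : good (mpolyX C (mnm1 c)).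
  rewrite /good; have [->|cb] := eqVneq c b.
    by exists 'X => w; rewrite mevalXU eqxx hornerX.
  by exists (z c)%:P => w; rewrite mevalXU (negPf cb) hornerC.
have good1 : good 1 by exists 1 => w; rewrite meval1 hornerC.
have goodXe c k : good (mpolyX C (mnm1 c) ^+ k).
  by elim: k => [|k IH]; rewrite ?expr0 // exprS; apply: goodM.
have goodm u : good (mpolyX C u).
  rewrite mpolyXE_id; elim/big_rec: _ => // c q _; exact: goodM.
elim/mpolyind: p => [|x u p _ _ [d dE]].
  by exists 0 => w; rewrite meval0 horner0.
have [e eE] := goodm u; exists (x *: e + d) => w.
by rewrite mevalD mevalZ eE dE hornerD hornerZ.
Qed.

End IteratedMeans.

(** * Integration of chat *)

(** The mean over z_c, for c < l, of the factor of label c, with x = z_l and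
    y = z_n. *)
Definition low_mean (A : comNzRingType) (k c : nat) (x y h : A) : A :=
  if (c < k)%N then (h - y) * (h - x)
  else if c == k then h * (h + h - y)
  else (h - y) * (h + h - x) + h ^+ 2.

Lemma rmorph_low_mean (A B : comNzRingType) (phi : {rmorphism A -> B}) k c x y h :
  phi (low_mean k c x y h) = low_mean k c (phi x) (phi y) (phi h).
Proof.
by rewrite /low_mean; do ![case: ifP => _];
  rewrite ?(rmorphB, rmorphD, rmorphN, rmorphM, rmorphXn).
Qed.

Lemma low_mean_quotient (F : fieldType) (i j k c : nat) (x y h : F) :
  (c < i)%N -> (i <= j)%N ->
  exists d p : {poly F}, [/\ (size p <= 1)%N,
    forall w, w != x ->
      (w - y + h) * num i j k c (w - x) h / den i k c (w - x) =
      d.[w] + p.[w] / (w - x)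
    & d.[0] = low_mean k c x y h].
Proof.
move=> ci ij; rewrite /num /den /low_mean (ltnW ci) ci andbT.
have [ck|ck|ck] := ltngtP c k.
- exists (('X - (y - h)%:P) * ('X - (x - h)%:P)), 0; split.
  + by rewrite size_poly0.
  + by move=> w _; rewrite horner0 hornerM !hornerXsubC mul0r addr0 divr1; ring.
  + by rewrite hornerM !hornerXsubC; ring.
- exists (('X - (y - h)%:P) * ('X - (x - h - h)%:P) + (h ^+ 2)%:P),
    (h ^+ 2 * (x - y + h))%:P; split.
  + exact: size_polyC_leq1.
  + move=> w wx; rewrite hornerD hornerM !hornerXsubC !hornerC; field.
    by rewrite subr_eq0.
  + by rewrite hornerD hornerM !hornerXsubC hornerC; ring.
- exists (h *: ('X - (y - h - h)%:P)), (h ^+ 2 * (x - y + h))%:P; split.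
  + exact: size_polyC_leq1.
  + move=> w wx; rewrite hornerZ !hornerXsubC !hornerC; field.
    by rewrite subr_eq0.
  + by rewrite hornerZ hornerXsubC; ring.
Qed.

Lemma ltn_ordS n (b c : 'I_n) : (c < b.+1)%N = (c == b) || (c < b)%N.
Proof. by rewrite ltnS leq_eqVlt. Qed.

Section Evaluation.

Variables (R : realType) (N : nat) (i j k l : 'I_N.+1) (h : R[i]).
Local Notation C := R[i].
Local Notation MP := (mpoly N.+1 C).
Local Notation radius b := ((val b).+2%:R^-1 : R).
Local Notation upd z b w := (fun b' => if b' == b then w else z b').
Implicit Types (z v : 'I_N.+1 -> C) (b c : 'I_N.+1).

Hypotheses (kl : (k <= l)%N) (li : (l <= i)%N) (ij : (i <= j)%N) (jN : (j < N)%N).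

Let lN : (l < N)%N. Proof. by lia. Qed.
Let lm : l != ord_max. Proof. by rewrite -(inj_eq val_inj) /= ltn_eqF. Qed.

Definition factor z c : C :=
  (z c - z ord_max + h) * num i j k c (z c - z l) h / den i k c (z c - z l).

Let X_ c : MP := mpolyX C (mnm1 c).
Let H_ : MP := mpolyC _ h.

(** The numerator of the function of z_l obtained after the integration over
    the z_c with c < l.  The signs turn the denominators z_c - z_l into the
    monic z_l - z_c. *)
Definition numerator (A : comNzRingType) (X : 'I_N.+1 -> A) (x hh : A) : A :=
  \prod_(c | others l c && (c < l)%N) low_mean k c x (X ord_max) hh *
  \prod_(c | others l c && (l < c)%N)
    ((-1) ^+ (c <= i)%N * ((X c - X ord_max + hh) * num i j k c (X c - x) hh)).

Lemma rmorph_numerator (A B : comNzRingType) (phi : {rmorphism A -> B})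
    (X : 'I_N.+1 -> A) (x hh : A) :
  phi (numerator X x hh) = numerator (phi \o X) (phi x) (phi hh).
Proof.
rewrite rmorphM !rmorph_prod; congr (_ * _); apply: eq_bigr => c _.
  exact: rmorph_low_mean.
by rewrite !rmorphM rmorph_num rmorphD !rmorphB rmorphXn rmorphN rmorph1.
Qed.

Let poles := [seq c : 'I_N.+1 <- enum 'I_N.+1 | (l < c <= i)%N].

Let P : {poly MP} := numerator (fun c => (X_ c)%:P) 'X H_%:P.
Let Q : {poly MP} := \prod_(c <- poles) ('X - (X_ c)%:P).
Let p0 : MP := (Pdiv.Ring.rdivp P Q).[0].

Let Q_monic : Q \is monic.
Proof. exact: monic_prod_XsubC. Qed.

Let PE : P = Pdiv.Ring.rdivp P Q * Q + Pdiv.Ring.rmodp P Q.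
Proof. exact: (Pdiv.RingMonic.rdivp_eq Q_monic). Qed.

Let rem_size : (size (Pdiv.Ring.rmodp P Q) <= size poles)%N.
Proof.
have := Pdiv.Ring.ltn_rmodpN0 P (monic_neq0 Q_monic).
by rewrite /Q size_prod_XsubC ltnS.
Qed.

(** Integrating a polynomial over z_c amounts to putting z_c = 0. *)
Let vanish m z c : C := if (c < m)%N then 0 else z c.

(** The mean of chat over the first m variables. *)
Definition stage m z : C :=
  if (m <= l)%N then
    \prod_(c | others l c)
       (if (c < m)%N then low_mean k c (z l) (z ord_max) h else factor z c)
  else meval (vanish m z) p0.

Let radius_lt b c : (b < c)%N -> radius c < radius b.
Proof. by move=> bc; rewrite ltf_pV2 ?posrE ?ltr0n // ltr_nat !ltnS. Qed.

(** Only the factor of label b depends on z_b; the others are constants that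
    are carried along. *)
Lemma stage_low b z : (b < l)%N ->
  (forall c, (b < c)%N -> normc (z c) = radius c) ->
  quotient_step (stage b) b z (stage b.+1 z).
Proof.
move=> bl zr; rewrite /stage bl.
have [d [p [sp dpE d0]]] :=
  low_mean_quotient k (z l) (z ord_max) h (leq_trans bl li) ij.
have lb : (l == b) = false by rewrite -(inj_eq val_inj) gtn_eqF.
have bm : b != ord_max by rewrite -(inj_eq val_inj) /= ltn_eqF // (ltn_trans bl).
have ob : others l b by rewrite /others bm eq_sym lb.
pose q := \prod_(c | others l c && (c != b))
   (if (c < b)%N then low_mean k c (z l) (z ord_max) h else factor z c).
exists [:: z l], (q *: d), (q *: p); split.
- by rewrite /= andbT zr // radius_lt.
- exact: leq_trans (size_scale_leq _ _) sp.
- move=> w wr; rewrite big_seq1 (ltnW bl) (bigD1 b) //= ltnn.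
  have -> : factor (upd z b w) b = d.[w] + p.[w] / (w - z l).
    rewrite /factor eqxx lb (eq_sym ord_max) (negPf bm) dpE //.
    by apply/eqP => e; have := radius_lt bl; rewrite -wr e zr // ltxx.
  rewrite [X in _ * X](_ : _ = q); first by rewrite !hornerZ; ring.
  apply: eq_bigr => c /andP[_ cb].
  by rewrite lb (eq_sym ord_max) (negPf bm) /factor (negPf cb) lb
    (eq_sym ord_max) (negPf bm).
- rewrite hornerZ d0 [RHS](bigD1 b) //= ltnSn mulrC; congr (_ * _).
  apply: eq_bigr => c /andP[_ cb].
  by rewrite ltn_ordS (negPf cb).
Qed.

(** No pole is left: the divisor is the empty product. *)
Lemma stage_high b z : (l < b)%N ->
  quotient_step (stage b) b z (stage b.+1 z).
Proof.
move=> lb; rewrite /stage leqNgt lb leqNgt (ltn_trans lb) //=.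
have [d dE] := meval_upd_horner p0 b (vanish b.+1 z).
exists [::], d, 0; split => //.
- by rewrite size_poly0.
- move=> w _; rewrite horner0 mul0r addr0 -dE; apply: meval_eq => c.
  rewrite /vanish ltn_ordS.
  by case: eqVneq => [->|_]; rewrite ?ltnn.
- rewrite -dE; apply: meval_eq => c; rewrite /vanish.
  by case: eqVneq => [->|_]; rewrite ?ltnSn.
Qed.

(** Specializing the Euclidean division of P by Q, made over the polynomials
    in the outer variables, at the values of these variables. *)
Lemma stage_pole z :
  (forall c, (l < c)%N -> normc (z c) = radius c) ->
  quotient_step (stage l) l z (stage l.+1 z).
Proof.
move=> zr; rewrite /stage leqnn ltnn; set v := vanish l.+1 z.
have vz c : (l < c)%N -> v c = z c by move=> lc; rewrite /v /vanish ltnS leqNgt lc.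
exists [seq z c | c <- poles], (map_poly (meval v) (Pdiv.Ring.rdivp P Q)),
  (map_poly (meval v) (Pdiv.Ring.rmodp P Q)); split.
- apply/allP => _ /mapP[c + ->]; rewrite mem_filter => /andP[/andP[lc _] _].
  by rewrite zr // radius_lt.
- by rewrite size_map (leq_trans (size_poly _ _) rem_size).
- move=> w wr; pose phi : {rmorphism {poly MP} -> C} := horner_eval w \o map_poly (meval v).
  have phiX : phi 'X = w by rewrite /phi /= map_polyX /horner_eval hornerX.
  have phiC (a : MP) : phi a%:P = meval v a by rewrite /phi /= map_polyC /horner_eval hornerC.
  have wz c : (l < c)%N -> w - z c != 0.
    move=> lc; rewrite subr_eq0; apply/eqP => e.
    by have := radius_lt lc; rewrite -wr e zr // ltxx.
  have phiQ : phi Q = \prod_(a <- [seq z c | c <- poles]) (w - a).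
    rewrite big_map rmorph_prod big_seq [RHS]big_seq; apply: eq_bigr => c.
    rewrite mem_filter => /andP[/andP[lc _] _].
    by rewrite rmorphB phiX phiC /= mevalXU vz.
  have Q0 : phi Q != 0.
    rewrite phiQ big_map prodf_seq_neq0; apply/allP => c.
    by rewrite mem_filter => /andP[/andP[lc _] _] /=; exact: wz.
  have -> : (map_poly (meval v) (Pdiv.Ring.rdivp P Q)).[w] +
      (map_poly (meval v) (Pdiv.Ring.rmodp P Q)).[w] /
      \prod_(a <- [seq z c | c <- poles]) (w - a) = phi P / phi Q.
    rewrite -phiQ {3}PE rmorphD rmorphM mulrDl mulfK //.
  have -> : phi P = numerator z w h.
    rewrite /P rmorph_numerator phiX (phiC H_) mevalC /numerator.
    have vzm : (phi \o (fun c => (X_ c)%:P)) ord_max = z ord_max.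
      by rewrite -[LHS]/(phi (X_ ord_max)%:P) phiC mevalXU vz.
    rewrite vzm; congr (_ * _); apply: eq_bigr => c /andP[_ lc].
    by rewrite -[(phi \o _) c]/(phi (X_ c)%:P) phiC mevalXU vz.
  rewrite phiQ (bigID (fun c : 'I_N.+1 => (c < l)%N)) /= /numerator -mulrA.
  congr (_ * _).
    apply: eq_bigr => c /andP[/andP[_ cl] cl'].
    by rewrite cl' eqxx eq_sym (negPf lm).
  have -> : \prod_(a <- [seq z c | c <- poles]) (w - a) =
      \prod_(c | others l c && (l < c)%N) (if (c <= i)%N then w - z c else 1).
    rewrite big_map big_filter big_enum_cond /= -big_mkcondr.
    apply: eq_bigl => c; rewrite /others -andbA.
    case: (ltnP l c) => lc //=; rewrite ?andbF //=.
    case: (leqP c i) => ci //=; rewrite ?andbF //= andbT -!(inj_eq val_inj) /=.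
    by rewrite !neq_ltn lc (leq_ltn_trans ci (leq_ltn_trans ij jN)) orbT.
  rewrite -prodf_div; apply: eq_big => [c|c /andP[/andP[cm cl] lc]].
    rewrite /others -leqNgt; case: eqVneq => //= _.
    by rewrite ltn_neqAle -(inj_eq val_inj) /= eq_sym; case: eqVneq.
  rewrite -leqNgt in lc; rewrite ltnNge lc /= /factor eqxx.
  rewrite (negPf cl) (eq_sym ord_max) (negPf lm) /den (leq_trans kl lc) /=.
  have lc' : (l < c)%N.
    by rewrite ltn_neqAle lc andbT; move: cl; rewrite -(inj_eq val_inj) eq_sym.
  case: (c <= i)%N; last by rewrite expr0 mul1r.
  rewrite expr1 -[w - z c]opprB invrN mulrN mulN1r mulNr opprK //.
- by rewrite -[in LHS](rmorph0 (meval v)) horner_map.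
Qed.

Lemma stage0 z : (forall c, normc (z c) = radius c) ->
  reduced_value (chat_rat C [set i; ord_max] [set j; ord_max]
                   [set k; ord_max] [set l; ord_max]) (Defs.point z h) = stage 0 z.
Proof.
move=> zr; rewrite reduced_chat // => a b ab.
have := zr a; rewrite ab zr => /invr_inj/eqP; rewrite eqr_nat !eqSS => /eqP.
by move=> /val_inj ->.
Qed.

Lemma poles_size : size poles = (i - l)%N.
Proof.
pose p (c : nat) := (l < c <= i)%N.
have -> : size poles = count p (iota 0 N.+1).
  by rewrite size_filter -val_enum_ord count_map.
have -> : iota 0 N.+1 = iota 0 (l.+1 + ((i - l) + (N - i))) by congr iota; lia.
rewrite !iotaD !count_cat add0n.
have in_iota (q : pred nat) (m r : nat) (e : bool) :
    (forall x : nat, (m <= x < m + r)%N -> q x = e) ->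
    count q (iota m r) = (e * r)%N.
  move=> qe; rewrite -[in RHS](size_iota m r) -[in RHS](count_predT (iota m r)).
  case: e qe => qe; rewrite ?mul0n ?mul1n.
    by apply: eq_in_count => c; rewrite mem_iota => /qe ->.
  rewrite -(count_pred0 (iota m r)).
  by apply: eq_in_count => c; rewrite mem_iota => /qe ->.
rewrite (in_iota p _ _ false) => [|c]; last by rewrite /p; lia.
rewrite (in_iota p _ _ true) => [|c]; last by rewrite /p; lia.
rewrite (in_iota p _ _ false) => [|c]; last by rewrite /p; lia.
lia.
Qed.

(** At z = 0 the divisor Q is 'X^(i - l), so that the constant term of the
    quotient is the coefficient of 'X^(i - l) in P. *)
Lemma stage_last z : stage N.+1 z = (numerator (fun=> 0) 'X h%:P)`_(i - l).
Proof.
rewrite /stage ltnNge (ltnW lN) /=; set v := vanish N.+1 z.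
have v0 c : v c = 0 by rewrite /v /vanish ltn_ord.
pose phi : {rmorphism {poly MP} -> {poly C}} := map_poly (meval v).
have phiX : phi 'X = 'X by exact: map_polyX.
have phiC (a : MP) : phi a%:P = (meval v a)%:P by exact: map_polyC.
have -> : numerator (fun=> 0) 'X h%:P = phi P.
  rewrite /P rmorph_numerator phiX phiC mevalC.
  congr numerator; apply: boolp.funext => c.
  by rewrite -[RHS]/(phi (X_ c)%:P) phiC mevalXU v0.
have -> : phi P = phi (Pdiv.Ring.rdivp P Q) * 'X ^+ (i - l) + phi (Pdiv.Ring.rmodp P Q).
  rewrite {1}PE rmorphD rmorphM; congr (_ * _ + _).
  rewrite /Q rmorph_prod -poles_size.
  elim: poles => [|c s IH]; first by rewrite big_nil.
  by rewrite big_cons IH exprS rmorphB phiX phiC mevalXU v0 subr0.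
rewrite coefD coefMXn ltnn subnn [X in _ + X]nth_default ?addr0.
  by rewrite -horner_coef0 -[in RHS](rmorph0 (meval v)) horner_map.
by rewrite -poles_size (leq_trans (size_poly _ _) rem_size).
Qed.

Lemma cstruct_coef :
  cstruct [set i; ord_max] [set j; ord_max] [set k; ord_max] [set l; ord_max] h =
  (numerator (fun=> 0) 'X h%:P)`_(i - l).
Proof.
rewrite /cstruct -(stage_last (fun=> 0)).
rewrite (@eq_iter_int _ _ [::] _ _ (fun z => stage 0 z / \prod_b z b)) //; last first.
  move=> z zr; rewrite stage0 // => c; apply: zr.
  by rewrite mem_rev mem_enum.
rewrite iter_int_mean; last first.
  move=> b z zr; have [bl|lb|bl] := ltngtP b l.
  - exact: stage_low.
  - exact: stage_high.
  - by rewrite (val_inj bl) in zr *; exact: stage_pole.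
rewrite mulrA -exprMn mul1r mulVf ?expr1n ?mul1r //.
rewrite !mulf_eq0 !negb_or pnatr_eq0 /= !eq_complex /= oner_eq0 andbF andbT.
by rewrite eqxx andbT gt_eqF // pi_gt0.
Qed.

End Evaluation.

(** * The numerators of the residues *)

Section ProductEvaluation.

Variables (A : comNzRingType) (X H : A).
Implicit Types (i j k l N c : nat).

(** [numerator] at 0 with - X for the variable z_l and without the signs,
    written with natural numbers as indices. *)
Definition residue_numerator i j k l N : A :=
  (\prod_(0 <= c < l) low_mean k c (- X) 0 H) *
  \prod_(l.+1 <= c < N) (H * num i j k c X H).

Lemma prod_nat_eq (f : nat -> A) (a b : nat) (v : A) :
  (forall c, (a <= c < b)%N -> f c = v) -> \prod_(a <= c < b) f c = v ^+ (b - a).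
Proof. by move=> fv; rewrite -prodr_const_nat; apply: eq_big_nat. Qed.

Lemma prod_low_mean k l : (k <= l)%N ->
  \prod_(0 <= c < l) low_mean k c (- X) 0 H =
  (H * (X + H)) ^+ k *
  (if (k < l)%N then 2 * H ^+ 2 * (H * (X + 3 * H)) ^+ (l - k - 1) else 1).
Proof.
move=> kl; rewrite (big_cat_nat (n := k)) //=; congr (_ * _).
  rewrite -[in RHS](subn0 k); apply: prod_nat_eq => c /andP[_ ck].
  by rewrite /low_mean ck; ring.
case: ltnP => lk; last by rewrite big_geq.
rewrite big_ltn // /low_mean ltnn eqxx; congr (_ * _); first by ring.
rewrite -subnDA addn1; apply: prod_nat_eq => c /andP[kc _].
by rewrite ltnNge (ltnW kc) /= gtn_eqF //; ring.
Qed.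

Lemma prod_num_tail i j k l N : (k <= l)%N -> (l <= i)%N -> (i <= j)%N -> (j < N)%N ->
  \prod_(i.+1 <= c < N) (H * num i j k c X H) =
  (if i == j then 1 else (H * (X + H)) ^+ (j - i - 1) * H ^+ 2)
  * (H * X) ^+ (N - j - 1).
Proof.
move=> kl li ij jN.
have E c : (i < c)%N -> H * num i j k c X H =
    if (c < j)%N then H * (X + H) else if c == j then H ^+ 2 else H * X.
  move=> ic; rewrite /num !ltnNge (leq_trans (leq_trans kl li) (ltnW ic)) /=.
  by rewrite (leqNgt c i) ic /=; case: ifP => // _; case: ifP => // _; rewrite expr2.
have tail : \prod_(j.+1 <= c < N) (H * num i j k c X H) = (H * X) ^+ (N - j - 1).
  rewrite -subnDA addn1; apply: prod_nat_eq => c /andP[jc _].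
  by rewrite E ?(leq_ltn_trans ij) // ltnNge (ltnW jc) /= gtn_eqF.
have [e|ij'] := eqVneq i j; first by rewrite mul1r -tail e.
have ij2 : (i < j)%N by rewrite ltn_neqAle ij' ij.
rewrite (big_cat_nat (n := j)) //=; last exact: ltnW.
rewrite [X in _ * X]big_ltn // tail mulrA; congr (_ * _ * _).
  rewrite -subnDA addn1; apply: prod_nat_eq => c /andP[ic cj].
  by rewrite E // cj.
by rewrite E // ltnn eqxx.
Qed.

Lemma prod_num i j k l N : (k <= l)%N -> (l < i)%N -> (i <= j)%N -> (j < N)%N ->
  \prod_(l.+1 <= c < N) (H * num i j k c X H) =
  (H * (X + H) ^+ 2) ^+ (i - l - 1)
  * (H * (if i == j then H ^+ 2 else H * (X + H)))
  * \prod_(i.+1 <= c < N) (H * num i j k c X H).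
Proof.
move=> kl li ij jN.
rewrite (big_cat_nat (n := i)) //=; last by lia.
rewrite [X in _ * X]big_ltn -?[RHS]mulrA; last by lia.
congr (_ * (_ * _)).
  rewrite -subnDA addn1; apply: prod_nat_eq => c /andP[lc ci].
  rewrite /num ltnNge (leq_trans kl (ltnW lc)) /= (ltnW ci) ci.
  by rewrite gtn_eqF // (leq_ltn_trans kl).
rewrite /num ltnNge (leq_trans kl (ltnW li)) /= leqnn ltnn.
by rewrite gtn_eqF // (leq_ltn_trans kl).
Qed.

Lemma residue_numerator_lk i j k N : (k < i)%N -> (i <= j)%N -> (j < N)%N ->
  residue_numerator i j k k N =
  H ^+ N.+1 * (X + H) ^+ (i + j - k - 2) * X ^+ (N - j - 1).
Proof.
move=> ki ij jN; rewrite /residue_numerator prod_low_mean // ltnn mulr1.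
rewrite prod_num // (prod_num_tail (leqnn k) (ltnW ki) ij jN).
move: (X + H) => Y; have [e|ij'] := eqVneq i j.
  have -> : N.+1 = (k + (i - k - 1) + (N - j - 1) + 3)%N by lia.
  have -> : (i + j - k - 2 = k + (i - k - 1) + (i - k - 1))%N by lia.
  by rewrite !exprMn !exprD; ring.
have -> : N.+1 = (k + (i - k - 1) + (j - i - 1) + (N - j - 1) + 4)%N by lia.
have -> : (i + j - k - 2 = k + (i - k - 1) + (i - k - 1) + (j - i - 1) + 1)%N by lia.
by rewrite !exprMn !exprD; ring.
Qed.

Lemma residue_numerator_klt i j k l N :
  (k < l)%N -> (l < i)%N -> (i <= j)%N -> (j < N)%N ->
  residue_numerator i j k l N =
  2 * H ^+ N.+2 * (X + H) ^+ (i + j + k - 2 * l - 2)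
  * (X + 3 * H) ^+ (l - k - 1) * X ^+ (N - j - 1).
Proof.
move=> kl li ij jN; rewrite /residue_numerator prod_low_mean ?(ltnW kl) // kl.
rewrite prod_num ?(ltnW kl) // (prod_num_tail (ltnW kl) (ltnW li) ij jN).
move: (X + H) (X + 3 * H) => Y Z; have [e|ij'] := eqVneq i j.
  have -> : N.+2 = (k + (l - k - 1) + (i - l - 1) + (N - j - 1) + 5)%N by lia.
  have -> : (i + j + k - 2 * l - 2 = k + (i - l - 1) + (i - l - 1))%N by lia.
  by rewrite !exprMn !exprD; ring.
have -> : N.+2 = (k + (l - k - 1) + (i - l - 1) + (j - i - 1) + (N - j - 1) + 6)%N by lia.
have -> : (i + j + k - 2 * l - 2 =
           k + (i - l - 1) + (i - l - 1) + (j - i - 1) + 1)%N by lia.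
by rewrite !exprMn !exprD; ring.
Qed.

Lemma residue_numerator_li i j k N : (k < i)%N -> (i <= j)%N -> (j < N)%N ->
  residue_numerator i j k i N =
  2 * H ^+ (N.+1 - (i == j)) * (X + H) ^+ (k + (j - i - 1) * (1 - (i == j)))
  * (X + 3 * H) ^+ (i - k - 1) * X ^+ (N - j - 1).
Proof.
move=> ki ij jN; rewrite /residue_numerator prod_low_mean ?(ltnW ki) // ki.
rewrite (prod_num_tail (ltnW ki) (leqnn i) ij jN).
move: (X + H) (X + 3 * H) => Y Z; have [e|ij'] := eqVneq i j.
  have -> : (N.+1 - true = k + (i - k - 1) + (N - j - 1) + 2)%N by rewrite /=; lia.
  by rewrite subnn muln0 addn0 !exprMn !exprD; ring.
have -> : (N.+1 - false = k + (i - k - 1) + (j - i - 1) + (N - j - 1) + 4)%N by rewrite /=; lia.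
by rewrite muln1 !exprMn !exprD; ring.
Qed.

Lemma residue_numerator_diag i j N : (i <= j)%N -> (j < N)%N ->
  residue_numerator i j i i N =
  H ^+ (N - (i == j)) * (X + H) ^+ (i + (j - i - 1) * (1 - (i == j)))
  * X ^+ (N - j - 1).
Proof.
move=> ij jN; rewrite /residue_numerator prod_low_mean // ltnn mulr1.
rewrite (prod_num_tail (leqnn i) (leqnn i) ij jN).
move: (X + H) => Y; have [e|ij'] := eqVneq i j.
  have -> : (N - true = i + (N - j - 1))%N by rewrite /=; lia.
  by rewrite subnn muln0 addn0 !exprMn !exprD; ring.
have -> : (N - false = i + (j - i - 1) + (N - j - 1) + 2)%N by rewrite /=; lia.
by rewrite muln1 !exprMn !exprD; ring.
Qed.

End ProductEvaluation.

Lemma coef_comp_polyNX (A : comNzRingType) (p : {poly A}) (m : nat) :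
  (p \Po - 'X)`_m = (-1) ^+ m * p`_m.
Proof.
elim/poly_ind: p m => [|p c IH] m; first by rewrite comp_poly0 coef0 mulr0.
rewrite comp_polyD comp_polyM comp_polyX comp_polyC mulrN !coefD coefN !coefMX !coefC.
by case: m => [|m] /=; rewrite ?expr0 ?IH ?exprS; ring.
Qed.

Lemma prod_others_lt (A : comNzRingType) N (l : 'I_N.+1) (f : nat -> A) :
  (l < N)%N ->
  \prod_(c | others l c && (c < l)%N) f c = \prod_(0 <= c < l) f c.
Proof.
move=> lN; rewrite (big_nat_widen 0 l N.+1) ?(ltnW (ltn_ord l)) // big_mkord.
apply: eq_bigl => c; rewrite /others -!(inj_eq val_inj) /=.
by case: ltnP => cl; rewrite ?andbF // !neq_ltn (ltn_trans cl lN) cl.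
Qed.

Lemma prod_others_gt (A : comNzRingType) N (l : 'I_N.+1) (f : nat -> A) :
  \prod_(c | others l c && (l < c)%N) f c = \prod_(l.+1 <= c < N) f c.
Proof.
rewrite (big_nat_widen l.+1 N N.+1) // (big_nat_widenl l.+1 0) // big_mkord.
apply: eq_bigl => c; rewrite /others -!(inj_eq val_inj) /=.
have := ltn_ord c; rewrite ltnS leq_eqVlt.
by case: ltngtP => //= cN _; case: ltngtP; rewrite ?andbF ?andbT.
Qed.

(** The sign (-1)^(i - l) of the i - l factors with a pole is compensated by
    the one that - 'X contributes to the coefficient of 'X^(i - l). *)
Lemma numerator_coef (F : comNzRingType) N (i j k l : 'I_N.+1) (h : F) :
  (k <= l)%N -> (l <= i)%N -> (i <= j)%N -> (j < N)%N ->
  (numerator i j k l (fun=> 0) 'X h%:P)`_(i - l) =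
  (residue_numerator 'X h%:P i j k l N)`_(i - l).
Proof.
move=> kl li ij jN; set S := residue_numerator _ _ _ _ _ _ _.
have sign : \prod_(l.+1 <= c < N) ((-1) ^+ (c <= i)%N : {poly F}) = (-1) ^+ (i - l).
  rewrite (big_cat_nat (n := i.+1)) //=; last by lia.
  rewrite (@prod_nat_eq _ _ _ _ (-1)) => [|c /andP[_ ci]]; last by rewrite -ltnS ci.
  rewrite (@prod_nat_eq _ _ _ _ 1) => [|c /andP[ci _]]; last by rewrite leqNgt ci.
  by rewrite expr1n mulr1 subSS.
suff E : numerator i j k l (fun=> 0) 'X h%:P \Po - 'X = (-1) ^+ (i - l) * S.
  have := coef_comp_polyNX (numerator i j k l (fun=> 0) 'X h%:P) (i - l).
  rewrite E -signr_odd -[(-1) ^+ (i - l)]signr_odd !mulr_sign.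
  by case: ifP => _; rewrite ?coefN // => /oppr_inj.
have -> : numerator i j k l (fun=> 0) 'X h%:P \Po - 'X =
    numerator i j k l (fun=> 0) (- 'X) h%:P.
  rewrite -[LHS]/(comp_poly (- 'X) _) rmorph_numerator /= comp_polyX comp_polyC.
  by congr numerator; apply: boolp.funext => c; exact: comp_poly0.
rewrite /numerator.
rewrite (prod_others_lt (fun c => low_mean k c (- 'X) 0 h%:P)) ?(leq_ltn_trans li) //; last lia.
rewrite (prod_others_gt l (fun c => (-1) ^+ (c <= i)%N *
  ((0 - 0 + h%:P) * num i j k c (0 - - 'X) h%:P))).
rewrite big_split /= sign mulrCA; congr (_ * (_ * _)).
by apply: eq_bigr => c _; rewrite subrr add0r sub0r opprK.
Qed.

(** * Comparison with the residues *)


Lemma laurent_quotient (K : fieldType) (x w : K) (a b : nat) (e : int) :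
  x != 0 -> e = b%:Z - a%:Z -> w / x ^ e = w * x ^+ a / x ^+ b.
Proof.
move=> x0 ->; rewrite expfzDr // -invr_expz -!exprnP invfM invrK mulrA.
by rewrite mulrAC.
Qed.

Lemma exprz_nat (K : unitRingType) (x : K) (a : nat) (e : int) :
  e = a%:Z -> x ^ e = x ^+ a.
Proof. by move=> ->. Qed.

Lemma top_label_pair N (I : {set 'I_N.+1}) :
  #|I| = 2%N -> N.+1 \in labels I ->
  exists i : 'I_N.+1, (i < N)%N /\ I = [set i; ord_max].
Proof.
move=> /pairP[a [b [ab IE]]] /labelsE[c cI [cN]]; exists a.
have bM : b = ord_max.
  have cM : c = ord_max by apply: val_inj.
  move: cI; rewrite IE cM !inE => /orP[] /eqP e //.
  by have := leq_trans ab (leq_ord b); rewrite -e /= ltnn.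
by split; [exact: leq_trans ab (leq_ord b)|rewrite IE bM].
Qed.

Lemma cstruct_eq0 (R : realType) n (I J K L : {set 'I_n}) (h : R[i]) :
  chat_rat R[i] I J K L = 0 -> cstruct I J K L h = 0.
Proof.
move=> chat0; rewrite /cstruct chat0.
have -> : (fun z : 'I_n -> R[i] =>
    reduced_value (0 : {fraction mpoly n.+1 R[i]}) (Defs.point z h) / \prod_(b < n) z b)
    = (fun z => (fun _ _ => 0) 0%N z / \prod_b z b).
  by apply: boolp.funext => z; rewrite reduced_value0.
rewrite (@iter_int_mean _ _ (fun _ _ => 0)) ?mulr0 // => b z _.
exists [::], 0, 0; split => //; first by rewrite size_poly0.
  by move=> w _; rewrite !horner0 mul0r addr0.
by rewrite horner0.
Qed.

Lemma cstruct_residue (R : realType) N (i j k l : 'I_N.+1) (h : R[i]) :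
  (k <= l)%N -> (l <= i)%N -> (i <= j)%N -> (j < N)%N ->
  cstruct [set i; ord_max] [set j; ord_max] [set k; ord_max] [set l; ord_max] h
  = (residue_numerator 'X h%:P i j k l N)`_(i - l).
Proof. by move=> *; rewrite cstruct_coef // numerator_coef. Qed.

(** The exponents of the statement are integers; here they are matched with
    the natural exponents of [residue_numerator], again in an abstract field. *)
Section Fractions.

Variables (F K : fieldType) (phi : {rmorphism {poly F} -> K}) (h : F).
Hypothesis X0 : phi 'X != 0.
Implicit Types i j k l N : nat.
Local Notation x := (phi 'X).
Local Notation w := (phi h%:P).

Lemma rmorph_powers (a b c d : nat) :
  phi (2 * h%:P ^+ a * ('X + h%:P) ^+ b * ('X + 3 * h%:P) ^+ c * 'X ^+ d) =
  2 * w ^+ a * (x + w) ^+ b * (x + 3 * w) ^+ c * x ^+ d.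
Proof. by rewrite !rmorphM rmorph_nat !rmorphXn !rmorphD rmorphM rmorph_nat. Qed.

Lemma fraction_lk i j k N : (k < i)%N -> (i <= j)%N -> (j < N)%N ->
  phi (residue_numerator 'X h%:P i j k k N) / x ^+ (i - k).+1 =
  w ^+ N.+1 * (x + w) ^ (i.+1%:Z + j.+1%:Z - k.+1%:Z - 3)
  / x ^ (i.+1%:Z + j.+1%:Z - k.+1%:Z - N.+1%:Z + 2).
Proof.
move=> ki ij jN; rewrite (@laurent_quotient _ _ _ (N - j - 1) (i - k).+1) //.
  rewrite residue_numerator_lk // !rmorphM !rmorphXn rmorphD.
  by rewrite (@exprz_nat _ _ (i + j - k - 2)) //; lia.
by lia.
Qed.

Lemma fraction_klt i j k l N : (k < l)%N -> (l < i)%N -> (i <= j)%N -> (j < N)%N ->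
  phi (residue_numerator 'X h%:P i j k l N) / x ^+ (i - l).+1 =
  2 * w ^+ N.+2 * (x + w) ^ (i.+1%:Z + j.+1%:Z + k.+1%:Z - 2 * l.+1%:Z - 3)
  * (x + 3 * w) ^ (l.+1%:Z - k.+1%:Z - 1)
  / x ^ (i.+1%:Z + j.+1%:Z - l.+1%:Z - N.+1%:Z + 2).
Proof.
move=> kl li ij jN; rewrite (@laurent_quotient _ _ _ (N - j - 1) (i - l).+1) //.
  rewrite residue_numerator_klt // rmorph_powers.
  rewrite (@exprz_nat _ _ (i + j + k - 2 * l - 2)) //; last by lia.
  by rewrite (@exprz_nat _ _ (l - k - 1)) //; lia.
by lia.
Qed.

Lemma fraction_li i j k N : (k < i)%N -> (i <= j)%N -> (j < N)%N ->
  let delta : nat := (i.+1 == j.+1)%N in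
  phi (residue_numerator 'X h%:P i j k i N) / x ^+ (i - i).+1 =
  2 * w ^ (N.+1%:Z - delta%:Z)
  * (x + w) ^ (k.+1%:Z - 1 + (j.+1%:Z - i.+1%:Z - 1) * (1 - delta%:Z))
  * (x + 3 * w) ^ (i.+1%:Z - k.+1%:Z - 1) / x ^ (j.+1%:Z - N.+1%:Z + 2).
Proof.
move=> ki ij jN; rewrite eqSS /=.
rewrite (@laurent_quotient _ _ _ (N - j - 1) (i - i).+1) //; last by lia.
rewrite residue_numerator_li // rmorph_powers.
rewrite (@exprz_nat _ _ (N.+1 - (i == j))); last by case: eqP => _ /=; lia.
rewrite (@exprz_nat _ _ (k + (j - i - 1) * (1 - (i == j)))); last first.
  by case: eqP => e /=; rewrite ?muln0 ?muln1; lia.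
by rewrite (@exprz_nat _ _ (i - k - 1)) //; lia.
Qed.

End Fractions.

Lemma residue_numerator_diag0 (F : comNzRingType) (h : F) i j N :
  (i <= j)%N -> (j < N)%N ->
  (residue_numerator 'X h%:P i j i i N)`_0 =
  if j == N.-1 then h ^+ (2 * (N - 1)) else 0.
Proof.
move=> ij jN; rewrite residue_numerator_diag // coefMXn.
have [jE|jE] := eqVneq j N.-1; last by rewrite ifT //; lia.
rewrite (_ : (N - j - 1 = 0)%N) ?subn0 ?ltnn; last lia.
rewrite -horner_coef0 hornerM !horner_exp hornerD hornerX hornerC add0r -exprD.
by congr (_ ^+ _); case: eqP => e /=; rewrite ?muln0 ?muln1; lia.
Qed.

Theorem proposition4p8 (R : realType) (n : nat) (I J K L : {set 'I_n})
    (h : R[i]) :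
  (2 <= n)%N ->
  #|I| = 2%N -> #|J| = 2%N -> #|K| = 2%N -> #|L| = 2%N ->
  n \in labels I -> n \in labels J -> n \in labels K ->
  let i := elem I 0 in let j := elem J 0 in
  let k := elem K 0 in let l := elem L 0 in
  let c := cstruct I J K L h in
  let delta : nat := (i == j)%N in
  let z : {fraction {poly R[i]}} := tofrac 'X in
  let hz : {fraction {poly R[i]}} := tofrac h%:P in
  [/\ ~ [/\ n \in labels L, (k <= l)%N, (l <= i)%N & (l <= j)%N] -> c = 0,
      (k < i)%N -> (k <= l)%N -> (l <= i)%N -> (i <= j)%N -> n \in labels L ->
      [/\ l = k ->
          c = residue0
                (hz ^+ n * (z + hz) ^ (i%:Z + j%:Z - k%:Z - 3)
                 / z ^ (i%:Z + j%:Z - k%:Z - n%:Z + 2)),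
          (k < l)%N -> (l < i)%N ->
          c = residue0
                (2 * hz ^+ n.+1 * (z + hz) ^ (i%:Z + j%:Z + k%:Z - 2 * l%:Z - 3)
                 * (z + 3 * hz) ^ (l%:Z - k%:Z - 1)
                 / z ^ (i%:Z + j%:Z - l%:Z - n%:Z + 2))
        & l = i ->
          c = residue0
                (2 * hz ^ (n%:Z - delta%:Z)
                 * (z + hz) ^ (k%:Z - 1 + (j%:Z - i%:Z - 1) * (1 - delta%:Z))
                 * (z + 3 * hz) ^ (i%:Z - k%:Z - 1)
                 / z ^ (j%:Z - n%:Z + 2))]
    & K = I -> L = I -> (i <= j)%N ->
      c = if j == n.-1 then h ^+ (2 * (n - 2)) else 0].
Proof.
case: n I J K L => [//|N] I J K L n2 cI cJ cK cL nI nJ nK.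
have [i [iN ->]] := top_label_pair cI nI.
have [j [jN ->]] := top_label_pair cJ nJ.
have [k [kN ->]] := top_label_pair cK nK.
move=> /=; rewrite !elem_pair0 // eqSS !ltnS.
have Z0 : tofrac 'X != 0 :> {fraction {poly R[i]}} by rewrite tofrac_eq0 polyX_eq0.
split.
- move=> notall; apply: cstruct_eq0; apply: chat_rat_eq0 => //.
  apply/negP => /and4P[Lmax kl li lj]; apply: notall.
  by split=> //; apply/labelsE; exists ord_max.
- move=> ki kl li ij nL; have [l [lN LE]] := top_label_pair cL nL.
  move: kl li; rewrite {}LE !elem_pair0 // !ltnS => kl li.
  rewrite cstruct_residue // -residue0_polyX; split.
  + by move=> [lk]; congr residue0; rewrite lk; exact: fraction_lk.
  + by move=> kl' li'; congr residue0; exact: fraction_klt.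
  + by move=> [lE]; congr residue0; rewrite lE in kl *; exact: fraction_li.
- move=> KI LI ij; rewrite KI LI cstruct_residue // subnn residue_numerator_diag0 //.
  have -> : (j == N.-1 :> nat) = (j.+1 == N) by apply/eqP/eqP; lia.
  by rewrite subSS.
Qed.
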